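(* Let $\mathscr C$ be a hereditary class of graphs. Then the following are equivalent: (1) $\mathscr C$ is mutually algebraic; (2) $\mathscr C$ is transduction-equivalent to (in particular, is a perturbation of) a hereditary class of bounded degree graphs; (3) $\mathscr C$ is a transduction of the class of all cubic graphs; (4) $\mathscr C$ does not transduce the class of all star forests (equivalently, the class of all star forests is not a non-copying transduction of $\mathscr C$).
   Context: Graphs in classes are finite, undirected and loopless; a class of graphs is a set of graphs considered up to isomorphism, and every class contains the empty graph. A class is hereditary if it is closed under induced subgraphs. A cubic graph is a graph all of whose vertices have degree $3$. A star forest is a forest whose connected components are stars. A class of graphs has bounded degree if a constant bounds the maximum degree of all its graphs. For a set $\mathcal U$ of unary relation symbols, a $\mathcal U$-colored graph is a graph with additional unary relations in $\mathcal U$. Formulas are first-order. Mutual algebraicity. Given a (possibly infinite) structure $M$, an $n$-ary relation $R(\bar x)$ on $M$ is mutually algebraic if there is a constant $K$ such that for each $m\in M$, the number of tuples $\bar b\in M^n$ with $M\models R(\bar b)$ and $m\in\bar b$ is at most $K$. A formula $\phi(\bar x)$ is mutually algebraic (in $M$) if it defines a mutually algebraic relation on $M^{|\bar x|}$. The structure $M$ is mutually algebraic if every formula with parameters from $M$ is equivalent in $M$ to a Boolean combination of mutually algebraic formulas with parameters from $M$. A hereditary class $\mathscr C$ is mutually algebraic if every (possibly infinite) model of $\mathrm{Th}(\mathscr C):=\bigcap_{M\in\mathscr C}\mathrm{Th}(M)$ is mutually algebraic, where $\mathrm{Th}(M)$ is the set of first-order sentences true in $M$. Transductions. For a positive integer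 $k$, the $k$-copy operation $\mathsf C_k$ maps a graph $G$ to the graph consisting of $k$ copies of $G$ in which the $k$ copies of each vertex are made pairwise adjacent (no other edges between the copies); $\mathsf C_1$ is the identity. The coloring operation $\Gamma_{\mathcal U}$ maps a graph to the set of all its $\mathcal U$-expansions. A simple interpretation $\mathsf I=(\nu(x),\eta(x,y))$ of graphs in $\mathcal U$-colored graphs is a pair of first-order formulas with $\eta$ symmetric and anti-reflexive; $\mathsf I(G^+)$ is the graph with vertex set $\nu(G^+)$ and edge set $\eta(G^+)\cap\nu(G^+)^2$. A transduction is a composition $\mathsf T=\mathsf I\circ\Gamma_{\mathcal U}\circ\mathsf C_k$, so $\mathsf T(G)=\{\mathsf I(G^+): G^+\in\Gamma_{\mathcal U}(\mathsf C_k(G))\}$; it is non-copying if it can be written with $k=1$. For a class $\mathscr D$, $\mathsf T(\mathscr D)=\bigcup_{G\in\mathscr D}\mathsf T(G)$ up to isomorphism. A class $\mathscr C$ is a (non-copying) transduction of $\mathscr D$ (equivalently, $\mathscr D$ (non-copying) transduces $\mathscr C$) if $\mathscr C\subseteq\mathsf T(\mathscr D)$ for some (non-copying) transduction $\mathsf T$. Two classes are transduction-equivalent if each is a transduction of the other. Perturbations. A subset complementation is the transduction that chooses a subset $M$ of vertices (a unary relation) and complements the adjacency inside $M$. A perturbation is a composition of a bounded number of subset complementations. A class $\mathscr C$ is a perturbation of $\mathscr D$ if $\mathscr C\subseteq\mathsf P(\mathscr D)$ for some perturbation $\mathsf P$. *)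

(* Defs.v *)
From mathcomp Require Import all_boot.
From mathcomp Require Import boolp classical_sets functions cardinality.

Set Implicit Arguments.
Unset Strict Implicit.
Unset Printing Implicit Defensive.

Local Open Scope classical_set_scope.
Local Open Scope card_scope.

(** * Graphs and classes of graphs *)

Record sgraph := SGraph {
  vertex :> finType;
  adj : rel vertex;
  adj_sym : symmetric adj;
  adj_irrefl : irreflexive adj }.

Definition graph_iso (G H : sgraph) : Prop :=
  exists2 f : G -> H, bijective f & forall x y, adj (f x) (f y) = adj x y.

Definition degree (G : sgraph) (x : G) : nat := #|[pred y | adj x y]|.

Section Induced.
Variables (G : sgraph) (A : pred G).
Definition induced_adj : rel {x : G | A x} := fun u v => adj (val u) (val v).
Fact induced_sym : symmetric induced_adj.
Proof. by move=> u v; apply: adj_sym. Qed.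
Fact induced_irrefl : irreflexive induced_adj.
Proof. by move=> u; apply: adj_irrefl. Qed.
Definition induced : sgraph := SGraph induced_sym induced_irrefl.
End Induced.

Definition empty_graph : sgraph :=
  @SGraph void (fun _ _ => false) (fun _ _ => erefl) (fun _ => erefl).

(* A collection of graphs. This is not [set sgraph] because [sgraph] lies in a
   universe above that of the argument of [set]. *)
Definition graphs := sgraph -> Prop.

Definition subclass (C D : graphs) : Prop := forall G, C G -> D G.

(* "A set of graphs considered up to isomorphism" is an isomorphism-invariant
   collection of graphs. *)
Definition graph_class (C : graphs) : Prop :=
  (forall G H, graph_iso G H -> C G -> C H) /\ C empty_graph.

Definition hereditary (C : graphs) : Prop :=
  forall (G : sgraph) (A : pred G), C G -> C (induced A).

Definition bounded_degree (C : graphs) : Prop :=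
  exists d : nat, forall G : sgraph, C G -> forall x : G, degree x <= d.

Definition cubic_graphs : graphs := fun G => forall x : G, degree x = 3.

Definition forest (G : sgraph) : Prop :=
  forall s : seq G, ucycle (@adj G) s -> size s <= 2.

(* The graphs K_{1,m} with m >= 0; the one-vertex graph is a star. *)
Definition star (G : sgraph) : Prop :=
  exists c : G, forall x y : G, adj x y = (x != y) && ((x == c) || (y == c)).

Definition star_forests : graphs := fun G =>
  forest G /\ forall x : G, star (induced (connect (@adj G) x)).

(** * First-order logic of colored graphs *)

(* Formulas in the language of U-colored graphs, with free variables in V.
   A quantifier binds the extra variable [None]. *)
Inductive form (U V : Type) : Type :=
| Eq of V & V
| Adj of V & V
| Col of U & V
| Neg of form U V
| And of form U V & form U V
| Ex of form U (option V).

Fixpoint form_map (U V W : Type) (h : V -> W) (phi : form U V) : form U W :=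
  match phi with
  | Eq x y => Eq U (h x) (h y)
  | Adj x y => Adj U (h x) (h y)
  | Col u x => Col u (h x)
  | Neg psi => Neg (form_map h psi)
  | And psi chi => And (form_map h psi) (form_map h chi)
  | Ex psi => Ex (form_map (omap h) psi)
  end.

(* Structures in the language of U-colored graphs. They may be infinite, and
   their relations are arbitrary. *)
Record structure (U : Type) := Structure {
  carrier :> Type;
  sadj : carrier -> carrier -> Prop;
  scol : U -> carrier -> Prop }.

Fixpoint sat (U : Type) (M : structure U) (V : Type) (phi : form U V) :
    (V -> M) -> Prop :=
  match phi with
  | Eq x y => fun e => e x = e y
  | Adj x y => fun e => sadj (e x) (e y)
  | Col u x => fun e => scol u (e x)
  | Neg psi => fun e => ~ sat psi e
  | And psi chi => fun e => sat psi e /\ sat chi e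
  | Ex psi => fun e => exists m : M, sat psi (oapp e m)
  end.

Definition sentence (U : Type) := form U void.

Definition holds (U : Type) (M : structure U) (phi : sentence U) : Prop :=
  sat phi (of_void M).

Definition Th (U : Type) (M : structure U) : set (sentence U) :=
  [set phi | holds M phi].

Definition coloring (U : Type) (G : sgraph) := U -> pred G.

Definition colored_graph (U : Type) (G : sgraph) (c : coloring U G) :
    structure U :=
  @Structure U G (fun x y => adj x y) (fun u x => c u x).

Definition graph_structure (G : sgraph) : structure void :=
  @colored_graph void G (fun u => of_void _ u).

Definition Th_class (C : graphs) : set (sentence void) :=
  [set phi | forall G : sgraph, C G -> Th (graph_structure G) phi].

Definition model_of (U : Type) (T : set (sentence U)) (M : structure U) : Prop :=
  forall phi, T phi -> holds M phi.

(** * Mutual algebraicity *)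

Definition ma_relation (M : Type) (n : nat) (R : set (n.-tuple M)) : Prop :=
  exists K : nat, forall m : M,
    [set b : n.-tuple M | R b /\ exists i, tnth b i = m] #<= `I_K.

(* Formulas phi(x_0, .., x_{n-1}) with parameters from M: the free names are
   the n variables and the elements of M. *)
Definition pform (U : Type) (M : structure U) (n : nat) := form U ('I_n + M).

Definition penv (M : Type) (n : nat) (b : n.-tuple M) (v : 'I_n + M) : M :=
  match v with inl i => tnth b i | inr m => m end.

Definition psat (U : Type) (M : structure U) (n : nat) (phi : pform M n)
    (b : n.-tuple M) : Prop :=
  sat phi (penv b).

Definition ma_form (U : Type) (M : structure U) (n : nat) (phi : pform M n) :
    Prop :=
  ma_relation [set b : n.-tuple M | psat phi b].

Definition prename (U : Type) (M : structure U) (k n : nat) (h : 'I_k -> 'I_n)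
    (phi : pform M k) : pform M n :=
  form_map (fun v => match v with inl i => inl (h i) | inr m => inr m end) phi.

(* Boolean combinations, in the variables x_0, .., x_{n-1}, of mutually
   algebraic formulas. Each of the latter is in a subtuple of the x_i (selected
   by an injection h), because mutual algebraicity is sensitive to dummy
   variables. *)
Inductive ma_combination (U : Type) (M : structure U) (n : nat) :
    pform M n -> Prop :=
| ma_comb_atom k (h : 'I_k -> 'I_n) (phi : pform M k) :
    injective h -> ma_form phi -> ma_combination (prename h phi)
| ma_comb_neg phi : ma_combination phi -> ma_combination (Neg phi)
| ma_comb_and phi psi :
    ma_combination phi -> ma_combination psi -> ma_combination (And phi psi).

Definition mutually_algebraic (U : Type) (M : structure U) : Prop :=
  forall (n : nat) (phi : pform M n),
  exists2 psi : pform M n, ma_combination psi &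
    forall b : n.-tuple M, psat phi b <-> psat psi b.

Definition ma_class (C : graphs) : Prop :=
  forall M : structure void, model_of (Th_class C) M -> mutually_algebraic M.

(** * Transductions *)

Section Copy.
Variables (k : nat) (G : sgraph).
Definition copy_adj : rel ('I_k * G) := fun u v =>
  ((u.1 == v.1) && adj u.2 v.2) || ((u.1 != v.1) && (u.2 == v.2)).
Fact copy_sym : symmetric copy_adj.
Proof.
by move=> u v; rewrite /copy_adj adj_sym ![_ == v.1]eq_sym ![_ == v.2]eq_sym.
Qed.
Fact copy_irrefl : irreflexive copy_adj.
Proof. by move=> u; rewrite /copy_adj adj_irrefl !eqxx. Qed.
Definition copy : sgraph := SGraph copy_sym copy_irrefl.
End Copy.

Definition sat1 (U : Type) (M : structure U) (phi : form U 'I_1) (x : M) : Prop :=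
  sat phi (tnth [tuple x]).

Definition sat2 (U : Type) (M : structure U) (phi : form U 'I_2) (x y : M) :
    Prop :=
  sat phi (tnth [tuple x; y]).

Record interpretation (U : Type) := Interpretation {
  nu : form U 'I_1;
  eta : form U 'I_2;
  eta_sym : forall (G : sgraph) (c : coloring U G) (x y : colored_graph c),
    sat2 eta x y -> sat2 eta y x;
  eta_irrefl : forall (G : sgraph) (c : coloring U G) (x : colored_graph c),
    ~ sat2 eta x x }.

Section Interpret.
Variables (U : Type) (I : interpretation U) (G : sgraph) (c : coloring U G).
Definition interpret_vertex : pred G :=
  fun x => `[< @sat1 U (colored_graph c) (nu I) x >].
Definition interpret_adj : rel {x : G | interpret_vertex x} := fun x y =>
  `[< @sat2 U (colored_graph c) (eta I) (val x) (val y) >].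
Fact interpret_sym : symmetric interpret_adj.
Proof. by move=> x y; apply: asbool_equiv_eq; split; apply: eta_sym. Qed.
Fact interpret_irrefl : irreflexive interpret_adj.
Proof. by move=> x; apply/asboolPn/eta_irrefl. Qed.
Definition interpret : sgraph := SGraph interpret_sym interpret_irrefl.
End Interpret.

Record transduction := Transduction {
  copies : nat;
  copies_gt0 : 0 < copies;
  colors : Type;
  interp : interpretation colors }.

(* The set T(G), closed under isomorphism. *)
Definition transduce (T : transduction) (G : sgraph) : graphs := fun H =>
  exists c : coloring (colors T) (copy (copies T) G),
    graph_iso (interpret (interp T) c) H.

Definition transduce_class (T : transduction) (D : graphs) : graphs := fun H =>
  exists2 G : sgraph, D G & transduce T G H.

Definition noncopying (T : transduction) : Prop :=
  exists2 T' : transduction, copies T' = 1 &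
    forall G H : sgraph, transduce T G H <-> transduce T' G H.

Definition transduction_of (C D : graphs) : Prop :=
  exists T : transduction, subclass C (transduce_class T D).

Definition noncopying_transduction_of (C D : graphs) : Prop :=
  exists2 T : transduction, noncopying T & subclass C (transduce_class T D).

Definition transduction_equivalent (C D : graphs) : Prop :=
  transduction_of C D /\ transduction_of D C.

(** * Perturbations *)

Section SubsetComplement.
Variables (G : sgraph) (A : pred G).
Definition compl_adj : rel G := fun x y =>
  if [&& A x, A y & x != y] then ~~ adj x y else adj x y.
Fact compl_sym : symmetric compl_adj.
Proof. by move=> x y; rewrite /compl_adj adj_sym eq_sym andbCA. Qed.
Fact compl_irrefl : irreflexive compl_adj.
Proof. by move=> x; rewrite /compl_adj eqxx !andbF adj_irrefl. Qed.
Definition subset_complement : sgraph := SGraph compl_sym compl_irrefl.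
End SubsetComplement.

(* The composition of p subset complementations, closed under isomorphism. *)
Fixpoint perturb (p : nat) (G : sgraph) : graphs := fun H =>
  if p is q.+1 then exists A : pred G, perturb q (subset_complement A) H
  else graph_iso G H.

Definition perturb_class (p : nat) (D : graphs) : graphs := fun H =>
  exists2 G : sgraph, D G & perturb p G H.

Definition perturbation_of (C D : graphs) : Prop :=
  exists p : nat, subclass C (perturb_class p D).

(* Main.v *)
(** The pivot between the conditions is [near_covered]: for some K, no graph of C
    has K vertices whose neighbourhoods pairwise differ in at least K places.

    If it holds, boundedly many cells of near-twins cover each graph. The
    vertices of small cells can be listed, and two large cells are joined almost
    completely or almost not at all, so boundedly many complementations leave a
    graph of bounded degree. As the property is first-order, the same description
    holds, with parameters, in every model of Th(C).

    If it fails, pigeonhole and Ramsey arguments extract large inflated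
    half-graphs, matchings or co-matchings, from which one formula produces all
    star forests; and an ultraproduct of the witnesses is a model of Th(C) that
    is not mutually algebraic.

    The link with formulas is a quantifier elimination in the spirit of Laskowski:
    if the edge relation is determined by the truth values of finitely many
    K-mutually algebraic predicates, so is every formula, with bounds depending
    on the formula only. This bounded form survives transductions, holds in
    bounded degree and forces [near_covered], which star forests violate. *)

(* The delicate point of the elimination is a single existential quantifier. That some value
   realizes exactly a given set of predicates is not a monotone condition, so it is not a projection
   of a mutually algebraic one; it is recovered by counting distinct witnesses of positive
   conditions, which are mutually algebraic as soon as they tie the quantified variable to a free
   one. Conditions on the quantified variable alone escape this, and they are the reason why
   parameters enter.

   The elimination serves two purposes: numerical bounds that are uniform over a class of finite
   graphs, and actual formulas in one infinite model. It is therefore carried out over an abstract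
   collection [D] of admissible predicates, which consists of all predicates in the first case and
   of those definable with parameters in the second. *)
Require Import Defs.
From mathcomp Require Import all_boot.
From mathcomp Require Import boolp classical_sets functions cardinality filter.
From mathcomp Require Import zify.

Set Implicit Arguments.
Unset Strict Implicit.
Unset Printing Implicit Defensive.

(** * Formulas *)

Definition of_I0 (T : Type) (i : 'I_0) : T := match notF (ltn_ord i) with end.

Section Formulas.
Variables (U : Type).

Lemma sat_map (M : structure U) V (phi : form U V) W (h : V -> W) (e : W -> M) :
  sat (form_map h phi) e <-> sat phi (e \o h).
Proof.
elim: phi W h e => //= [{}V psi IH|{}V p IHp q IHq|{}V psi IH] W h e.
- by rewrite IH.
- by rewrite IHp IHq.
- have oE m : oapp e m \o omap h = oapp (e \o h) m by apply/funext; case.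
  by split=> -[m]; [rewrite IH oE|rewrite -oE -IH]; exists m.
Qed.

Lemma sat_iso (M N : structure U) (f : M -> N) (g : N -> M) :
    cancel f g -> cancel g f ->
    (forall x y, sadj x y <-> sadj (f x) (f y)) ->
    (forall u x, scol u x <-> scol u (f x)) ->
  forall V (phi : form U V) (e : V -> M), sat phi e <-> sat phi (f \o e).
Proof.
move=> fK gK fadj fcol V; elim=> /=.
- by move=> {}V x y e; split=> [->//|]; apply: (can_inj fK).
- by move=> {}V x y e; apply: fadj.
- by move=> {}V u x e; apply: fcol.
- by move=> {}V psi IH e; rewrite IH.
- by move=> {}V p IHp q IHq e; rewrite IHp IHq.
move=> {}V psi IH e.
have oE m : f \o oapp e m = oapp (f \o e) (f m) by apply/funext; case.
split=> -[m]; first by rewrite IH oE; exists (f m).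
by rewrite -(gK m) -oE -IH; exists (g m).
Qed.

Definition Or V (p q : form U V) := Neg (And (Neg p) (Neg q)).
Definition Imp V (p q : form U V) := Neg (And p (Neg q)).
Definition Iff V (p q : form U V) := And (Imp p q) (Imp q p).
Definition All V (p : form U (option V)) := Neg (Ex (Neg p)).

Fixpoint Exn (c : nat) : forall V, form U ('I_c + V) -> form U V :=
  match c return forall V, form U ('I_c + V) -> form U V with
  | 0 => fun V phi => form_map (fun v : 'I_0 + V => match v with
      inl i => of_I0 V i | inr v => v end) phi
  | c'.+1 => fun V phi => Exn (Ex (form_map (fun v : 'I_c'.+1 + V => match v with
      inl i => omap (@inl 'I_c' V) (unlift ord0 i) | inr v => Some (inr v) end) phi))
  end.

Definition envn (M : Type) c V (b : 'I_c -> M) (e : V -> M) (v : 'I_c + V) : M :=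
  match v with inl i => b i | inr v => e v end.

Variable M : structure U.

Lemma sat_Or V (p q : form U V) (e : V -> M) :
  sat (Or p q) e <-> sat p e \/ sat q e.
Proof. by rewrite /= -not_orE notK. Qed.

Lemma sat_Imp V (p q : form U V) (e : V -> M) :
  sat (Imp p q) e <-> (sat p e -> sat q e).
Proof.
split=> /= [H pe|H [/H//]]; apply: contrapT => nq; exact: H.
Qed.

Lemma sat_Iff V (p q : form U V) (e : V -> M) :
  sat (Iff p q) e <-> (sat p e <-> sat q e).
Proof. by rewrite /Iff; split=> [[/sat_Imp ? /sat_Imp ?]|[? ?]] //; split; apply/sat_Imp. Qed.

Lemma sat_All V (p : form U (option V)) (e : V -> M) :
  sat (All p) e <-> forall m, sat p (oapp e m).
Proof.
split=> /= [H m|H [m]]; last exact.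
by apply: contrapT => np; apply: H; exists m.
Qed.

Lemma sat_Exn c V (phi : form U ('I_c + V)) (e : V -> M) :
  sat (Exn phi) e <-> exists b : 'I_c -> M, sat phi (envn b e).
Proof.
elim: c V phi e => [|c IH] V phi e /=.
  rewrite sat_map; set e' := _ \o _.
  suff eE b : envn b e = e' by split=> [|[b]]; rewrite ?eE //; exists (of_I0 M); rewrite eE.
  by apply/funext => -[[]|].
rewrite IH; split=> -[b] /=.
  move=> [m]; rewrite sat_map => H.
  exists (fun i => oapp b m (unlift ord0 i)); congr (sat phi _): H.
  by apply/funext => -[i|v] //=; case: unlift.
move=> H; exists (fun i => b (lift ord0 i)), (b ord0).
rewrite sat_map; congr (sat phi _): H.
apply/funext => -[i|v] //=.
by case: unliftP => [j|] ->.
Qed.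

End Formulas.

(** The syntax has no constant for truth, so the empty conjunction is an equation [v0 = v0], for
    which some name [v0] must be supplied. *)
Definition Allf (U V : Type) (v0 : V) (I : finType) (F : I -> form U V) : form U V :=
  foldr (@And U V) (Eq U v0 v0) [seq F i | i <- enum I].

Definition Exf (U V : Type) (v0 : V) (I : finType) (F : I -> form U V) : form U V :=
  Neg (Allf v0 (fun i => Neg (F i))).

Lemma sat_Allf U (M : structure U) V v0 (I : finType) (F : I -> form U V) (e : V -> M) :
  sat (Allf v0 F) e <-> forall i, sat (F i) e.
Proof.
rewrite /Allf; have: forall i, i \in enum I by move=> i; rewrite mem_enum.
move=> mem; transitivity (forall i, i \in enum I -> sat (F i) e); last first.
  by split=> H i; [apply: H|move=> _; apply: H].
elim: (enum I) => [|i s IH] /=; first by split.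
rewrite IH; split=> [[Hi Hs] j|H].
  by rewrite inE => /predU1P[->//|/Hs].
by split=> [|j js]; apply: H; rewrite inE ?eqxx ?js ?orbT.
Qed.

Lemma sat_Exf U (M : structure U) V v0 (I : finType) (F : I -> form U V) (e : V -> M) :
  sat (Exf v0 F) e <-> exists i, sat (F i) e.
Proof.
rewrite /Exf /= sat_Allf /=; split=> [|[i Fi] /(_ i)//].
by move/existsNP => [i /contrapT]; exists i.
Qed.

(** * Mutually algebraic predicates *)

Section AtMost.
Variable M : eqType.

(** Stated with duplicate-free lists so that it applies to arbitrary predicates on infinite
    carriers; a bare type is used through [{classic M}]. *)
Definition atmost (k : nat) (P : M -> Prop) : Prop :=
  forall s : seq M, uniq s -> (forall x, x \in s -> P x) -> size s <= k.

Lemma atmost_sub k l (P Q : M -> Prop) :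
  k <= l -> (forall x, P x -> Q x) -> atmost k Q -> atmost l P.
Proof.
move=> kl PQ Qk s us sP; apply: leq_trans kl; apply: Qk => // x /sP; exact: PQ.
Qed.

(** A longest duplicate-free list inside [P] must exhaust [P]. *)
Lemma atmost_list k P : atmost k P ->
  exists s : seq M, [/\ uniq s, size s <= k & forall x, x \in s <-> P x].
Proof.
move=> Pk.
pose q n := `[< exists s : seq M, [/\ uniq s, forall x, x \in s -> P x & size s = n] >].
have q0 : exists n, q n by exists 0; apply/asboolP; exists [::].
have qk n : q n -> n <= k by move=> /asboolP[s [us sP <-]]; apply: Pk.
case: (ex_maxnP q0 qk) => n /asboolP[s [us sP sn]] nmax.
exists s; split=> // [|x]; first exact: Pk.
split=> [/sP//|Px]; apply: contraT => xs.
suff : n.+1 <= n by rewrite ltnn.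
apply: nmax; apply/asboolP; exists (x :: s); split; rewrite /= ?sn ?xs //.
by move=> y; rewrite inE => /predU1P[->|/sP].
Qed.

Lemma atmost_cover k (s : seq M) (P : M -> Prop) :
  size s <= k -> (forall x, P x -> x \in s) -> atmost k P.
Proof.
by move=> sk Ps t ut tP; apply: leq_trans sk; apply: uniq_leq_size => // x /tP/Ps.
Qed.

Lemma atmost_ex (I : finType) k (P : I -> M -> Prop) :
  (forall i, atmost k (P i)) -> atmost (#|I| * k) (fun x => exists i, P i x).
Proof.
move=> Pk; have [s sP] := choice (fun i => atmost_list (Pk i)).
apply: (@atmost_cover _ (flatten [seq s i | i <- enum I])); last first.
  move=> x [i Pix]; apply/flattenP; exists (s i); last by have [_ _ ->] := sP i.
  by rewrite map_f // mem_enum.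
rewrite cardE; elim: (enum I) => //= i r IH.
by rewrite size_cat mulSn leq_add //; case: (sP i).
Qed.

Lemma atmost_or k l (P Q : M -> Prop) :
  atmost k P -> atmost l Q -> atmost (k + l) (fun x => P x \/ Q x).
Proof.
move=> /atmost_list[s [_ sk sP]] /atmost_list[t [_ tl tQ]].
apply: (@atmost_cover _ (s ++ t)); first by rewrite size_cat leq_add.
by move=> x [/sP|/tQ] xs; rewrite mem_cat xs ?orbT.
Qed.

Lemma atmost_inj k (P : M -> Prop) (b : 'I_k.+1 -> M) :
  injective b -> (forall i, P (b i)) -> ~ atmost k P.
Proof.
move=> bI bP /(_ [seq b i | i <- enum 'I_k.+1]).
rewrite map_inj_uniq // enum_uniq size_map size_enum_ord ltnn => /(_ isT) H.
by suff: false by []; apply: H => x /mapP[i _ ->].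
Qed.

Lemma not_atmost k (P : M -> Prop) : ~ atmost k P ->
  exists2 b : 'I_k.+1 -> M, injective b & forall i, P (b i).
Proof.
move=> /existsNP[s /not_implyP[us /not_implyP[sP /negP]]]; rewrite -ltnNge => ks.
case: s us sP ks => // x0 s us sP ks.
exists (fun i : 'I_k.+1 => nth x0 (x0 :: s) i) => [i j ij|i]; last first.
  by apply: sP; rewrite mem_nth // (leq_trans (ltn_ord i)).
apply: val_inj; apply/eqP; rewrite -(nth_uniq x0 _ _ us) ?ij //.
  by rewrite (leq_trans (ltn_ord i)).
by rewrite (leq_trans (ltn_ord j)).
Qed.

End AtMost.

Definition agree (V M : Type) (S : V -> Prop) (e e' : V -> M) : Prop :=
  forall v, S v -> e v = e' v.

(* [ma_relation] for predicates on environments that depend only on the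
   variables in S. The environments are covered by K of them rather than
   counted, so that V may be infinite. *)
Definition ma_on (M : Type) (K : nat) (V : Type) (S : V -> Prop)
    (R : (V -> M) -> Prop) : Prop :=
  (forall e e', agree S e e' -> R e -> R e') /\
  (forall v m, S v -> exists L : nat -> V -> M, forall e, R e -> e v = m ->
    exists2 i, i < K & agree S e (L i)).

Section MutuallyAlgebraic.
Variable M : Type.

Lemma ma_on_fin K V (S : V -> Prop) (R : (V -> M) -> Prop) :
    (forall e e', agree S e e' -> R e -> R e') ->
    (forall v m, S v -> exists (T : finType) (L : T -> V -> M), #|T| <= K /\
      forall e, R e -> e v = m -> exists t, agree S e (L t)) ->
  ma_on K S R.
Proof.
move=> RS H; split=> // v m /(H v m)[T [L [TK TL]]].
exists (fun n => nth (fun=> m) [seq L t | t <- enum T] n) => e Re ev.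
have [t et] := TL e Re ev; exists (enum_rank t).
  by apply: leq_trans TK; apply: ltn_ord.
rewrite (nth_map t) ?nth_enum_rank //.
by rewrite -cardE ltn_ord.
Qed.

Lemma ma_on_weaken K K' V (S : V -> Prop) (R : (V -> M) -> Prop) :
  K <= K' -> ma_on K S R -> ma_on K' S R.
Proof.
move=> KK' [RS RK]; split=> // v m /(RK v m)[L LR]; exists L => e Re /(LR e Re).
by case=> i iK; exists i => //; apply: leq_trans KK'.
Qed.

Lemma ma_on_sub K V (S : V -> Prop) (R R' : (V -> M) -> Prop) :
    (forall e e', agree S e e' -> R' e -> R' e') -> (forall e, R' e -> R e) ->
  ma_on K S R -> ma_on K S R'.
Proof.
move=> R'S R'R [_ RK]; split=> // v m /(RK v m)[L LR].
by exists L => e /R'R; apply: LR.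
Qed.

(** [f] may identify variables; a section of [f] over the image of the scope carries covers from [W]
    to [V]. *)
Lemma ma_on_map K V W (f : W -> V) (S : W -> Prop) (R : (W -> M) -> Prop) :
  ma_on K S R ->
  ma_on K (fun v => exists2 w, S w & f w = v) (fun e => R (e \o f)).
Proof.
move=> [RS RK]; split=> [e e' ee'|v m [w0 Sw0 fw0]].
  by apply: RS => w Sw; apply: ee'; exists w.
have /choice[g gP] : forall v, exists w, (exists2 w, S w & f w = v) -> S w /\ f w = v.
  move=> v'; have [[w Sw fw]|nw] := pselect (exists2 w, S w & f w = v').
    by exists w.
  by exists w0.
have [L LR] := RK w0 m Sw0.
exists (fun i => L i \o g) => e Re ev.
have [|i iK eL] := LR (e \o f) Re; first by rewrite /= fw0.
exists i => // v' /gP[Sg fg]; rewrite -{1}fg; exact: eL.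
Qed.

(** Covers restrict along [h]. Injectivity of [h] allows an environment on [V] to be glued to the
    values of a witness outside the image. *)
Lemma ma_on_proj K V W (h : V -> W) (S : W -> Prop) (R : (W -> M) -> Prop) :
  injective h -> ma_on K S R ->
  ma_on K (S \o h) (fun b => exists2 e, e \o h = b & R e).
Proof.
move=> hI [RS RK]; split=> [b b' bb' [e eb Re]|v m Sv].
  have /choice[e' e'P] : forall w, exists m, (forall v, h v = w -> m = b' v) /\
      ((forall v, h v <> w) -> m = e w).
    move=> w; have [[v vw]|nw] := pselect (exists v, h v = w).
      exists (b' v); split=> [v' v'w|/(_ v)//].
      by congr b'; apply: hI; rewrite vw.
    by exists (e w); split=> // v vw; case: nw; exists v.
  have e'h v : e' (h v) = b' v by apply: (proj1 (e'P (h v))).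
  exists e'; first by apply/funext.
  apply: RS Re => w Sw; have [[v vw]|nw] := pselect (exists v, h v = w).
    by rewrite -vw e'h -(bb' v) ?eb //= -?eb //= vw.
  by rewrite (proj2 (e'P w)) // => v vw; apply: nw; exists v.
have [L LR] := RK (h v) m Sv.
exists (fun i => L i \o h) => b [e <- Re] /(LR e Re)[i iK eL].
by exists i => // v' Sv'; apply: eL.
Qed.

(** The common variable [u] carries the bound: pinning one variable leaves [K] choices in a conjunct
    containing it, each of them fixes [u], and a value of [u] leaves [K] choices in each of the
    [#|I|] conjuncts. *)
Lemma ma_on_all K V (I : finType) (P : I -> Prop) (S : I -> V -> Prop)
    (R : I -> (V -> M) -> Prop) (u : V) :
    (forall i, P i -> ma_on K (S i) (R i)) -> (forall i, P i -> S i u) ->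
  ma_on (K ^ #|I|.+1) (fun v => exists2 i, P i & S i v)
    (fun e => forall i, P i -> R i e).
Proof.
move=> RK Su; apply: ma_on_fin => [e e' ee' Re i Pi|v m [i0 Pi0 Sv]].
  by apply: (proj1 (RK i Pi)) (Re i Pi) => v Sv; apply: ee'; exists i.
have [L0 L0R] := proj2 (RK i0 Pi0) v m Sv.
have /choice[L LR] : forall p : I * M, exists L : nat -> V -> M, P p.1 ->
    forall e, R p.1 e -> e u = p.2 -> exists2 j, j < K & agree (S p.1) e (L j).
  move=> [i m'] /=; have [Pi|nPi] := pselect (P i); last by exists (fun _ _ => m).
  by have [L LR] := proj2 (RK i Pi) u m' (Su i Pi); exists L.
exists ('I_K * {ffun I -> 'I_K})%type, (fun (t : 'I_K * {ffun I -> 'I_K}) w =>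
  if [pick i | `[< P i /\ S i w >]] is Some i then L (i, L0 t.1 u) (t.2 i) w
  else m); split.
  by rewrite card_prod card_ffun !card_ord expnS.
move=> e Re ev; have [k0 k0K ek0] := L0R e (Re i0 Pi0) ev.
have /choice[f fP] : forall i, exists j : 'I_K, P i -> agree (S i) e (L (i, L0 k0 u) j).
  move=> i; have [Pi|nPi] := pselect (P i); last by exists (Ordinal k0K).
  have [|j jK ej] := LR (i, L0 k0 u) Pi e (Re i Pi); first by apply: ek0; apply: Su.
  by exists (Ordinal jK).
exists (Ordinal k0K, [ffun i => f i]) => w [i Pi Sw] /=.
case: pickP => [j /asboolP[Pj Sj]|/(_ i)/asboolP[]//].
by rewrite ffunE; apply: fP.
Qed.

(** The operations by which the eliminating predicates are built: [D_param] serves the listed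
    exceptional values, [D_exn] the counting of distinct witnesses. *)
Record closed_definability (U : Type) (N : structure U)
    (D : forall V, ((V -> N) -> Prop) -> Prop) : Prop := ClosedDefinability {
  D_false : forall V, D V (fun=> False);
  D_eq : forall V (x y : V), D V (fun e => e x = e y);
  D_col : forall V u (x : V), D V (fun e => scol u (e x));
  D_map : forall V W (f : W -> V) R, D W R -> D V (fun e => R (e \o f));
  D_param : forall V R (a : N), D (option V) R -> D V (fun e => R (oapp e a));
  D_ex : forall V R, D (option V) R -> D V (fun e => exists y, R (oapp e y));
  D_exn : forall V c (I : finType) (P : 'I_c -> I -> Prop)
      (R : I -> (option V -> N) -> Prop), 0 < c -> (forall i, D (option V) (R i)) ->
    D V (fun e => exists2 b : 'I_c -> N, injective b &
      forall k i, P k i -> R i (oapp e (b k))) }.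

End MutuallyAlgebraic.

(* Semantic form of: phi is a Boolean combination of the Q i. *)
Definition tame (M : Type) (D : forall V, ((V -> M) -> Prop) -> Prop)
    (I : finType) (K : nat) (V : Type) (phi : (V -> M) -> Prop) : Prop :=
  exists Q : I -> (V -> M) -> Prop,
    (forall i, (exists S, ma_on K S (Q i)) /\ D V (Q i)) /\
    (forall e e', (forall i, Q i e <-> Q i e') -> phi e -> phi e').

(** * Quantifier elimination *)

Section Tame.
Variables (U : Type) (N : structure U) (D : forall V, ((V -> N) -> Prop) -> Prop).
Hypothesis Dc : closed_definability D.

Lemma tame_weaken I K K' V (phi : (V -> N) -> Prop) :
  K <= K' -> tame D I K phi -> tame D I K' phi.
Proof.
move=> KK' [Q [QD Qphi]]; exists Q; split=> // i.
have [[S SQ] DQ] := QD i; split=> //.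
by exists S; apply: ma_on_weaken SQ.
Qed.

Lemma tame_ext I K V (phi psi : (V -> N) -> Prop) :
  (forall e, phi e <-> psi e) -> tame D I K phi -> tame D I K psi.
Proof.
move=> pp [Q [QD Qphi]]; exists Q; split=> // e e' /Qphi ee'.
by rewrite -!pp.
Qed.

Lemma tame_atom K V (S : V -> Prop) (phi : (V -> N) -> Prop) :
  ma_on K S phi -> D phi -> tame D unit K phi.
Proof.
move=> pK pD; exists (fun=> phi); split=> [_|e e' /(_ tt)[]//].
by split=> //; exists S.
Qed.

Lemma tame_neg I K V (phi : (V -> N) -> Prop) :
  tame D I K phi -> tame D I K (fun e => ~ phi e).
Proof.
move=> [Q [QD Qphi]]; exists Q; split=> // e e' ee' ne /Qphi pe; apply/ne/pe.
by move=> i; rewrite ee'.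
Qed.

Lemma tame_and I K I' K' V (phi phi' : (V -> N) -> Prop) :
  tame D I K phi -> tame D I' K' phi' ->
  tame D (I + I')%type (maxn K K') (fun e => phi e /\ phi' e).
Proof.
move=> /(tame_weaken (leq_maxl K K'))[Q [QD Qphi]].
move=> /(tame_weaken (leq_maxr K K'))[Q' [QD' Qphi']].
exists (fun i => match i with inl i => Q i | inr i => Q' i end); split.
  by case=> i; [apply: QD|apply: QD'].
move=> e e' ee' [pe pe']; split.
  by apply: Qphi pe => i; apply: (ee' (inl i)).
by apply: Qphi' pe' => i; apply: (ee' (inr i)).
Qed.

Lemma tame_map I K V W (f : W -> V) (phi : (W -> N) -> Prop) :
  tame D I K phi -> tame D I K (fun e => phi (e \o f)).
Proof.
move=> [Q [QD Qphi]]; exists (fun i e => Q i (e \o f)); split=> [i|e e' ee'].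
  have [[S SQ] DQ] := QD i; split; last exact: (D_map Dc).
  by eexists; apply: ma_on_map SQ.
exact: Qphi.
Qed.

Lemma ma_on_false K V : @ma_on N K V (fun=> False) (fun=> False).
Proof. by []. Qed.

Lemma oapp_Some V (e : option V -> N) : e = oapp (e \o Some) (e None).
Proof. by apply/funext; case. Qed.

Lemma ma_on_some K V (S : option V -> Prop) (R : (option V -> N) -> Prop) :
  ma_on K S R -> ma_on K (S \o Some) (fun e => exists y, R (oapp e y)).
Proof.
have SI : injective (@Some V) by move=> x y [].
move=> /(ma_on_proj SI) H.
apply: ma_on_sub (H) => [e e' ee' [y Ry]|e [y Ry]]; last by exists (oapp e y).
have [e1 e1e Re1] : exists2 e1, e1 \o Some = e' & R e1.
  by apply: (proj1 H) ee' _; exists (oapp e y).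
by exists (e1 None); rewrite -e1e -oapp_Some.
Qed.

Lemma ma_on_param K V (S : option V -> Prop) (R : (option V -> N) -> Prop) a :
  ma_on K S R -> ma_on K (S \o Some) (fun e => R (oapp e a)).
Proof.
move=> RK; apply: ma_on_sub (ma_on_some RK) => [e e' ee'|e Re]; last by exists a.
by apply: (proj1 RK); case=> //= v /ee'.
Qed.

End Tame.

Section TameEx.
Variables (U : Type) (N : structure U) (D : forall V, ((V -> N) -> Prop) -> Prop).
Hypothesis Dc : closed_definability D.
Variables (I : finType) (K : nat) (V : Type) (Q : I -> (option V -> N) -> Prop).
Variable S : I -> option V -> Prop.
Hypothesis QS : forall i, ma_on K (S i) (Q i).
Hypothesis QD : forall i, D (Q i).

Definition mixed i := S i None /\ exists v, S i (Some v).

Lemma mixed_atmost i e : mixed i ->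
  atmost K (fun y : {classic N} => Q i (oapp e y)).
Proof.
move=> [S0 [v Sv]]; have [L LQ] := proj2 (QS i) (Some v) (e v) Sv.
apply: (@atmost_cover _ _ [seq (L j None : {classic N}) | j <- iota 0 K]).
  by rewrite size_map size_iota.
move=> y Qy; have [//|j jK ej] := LQ (oapp e y) Qy.
apply/mapP; exists j; first by rewrite mem_iota.
by rewrite -(ej None S0).
Qed.

Lemma no_None_indep i e y y' : ~ S i None -> Q i (oapp e y) -> Q i (oapp e y').
Proof. by move=> nS; apply: (proj1 (QS i)); case. Qed.

Lemma unary_indep i e e' y : ~ (exists v, S i (Some v)) ->
  Q i (oapp e y) -> Q i (oapp e' y).
Proof. by move=> nS; apply: (proj1 (QS i)); case=> // v Sv; case: nS; exists v. Qed.

(* c distinct values y_k realize all predicates in J, and y_k also realizes the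
   predicate s k. Comparing the truth values of these predicates, for all c and
   s, tells whether some y realizes exactly the predicates in J. *)
Definition witness_scheme (J : {set I}) c (s : 'I_c -> I) : Prop :=
  [/\ 0 < c, forall j, j \in J -> S j None, (exists2 j, j \in J & mixed j)
    & forall k, S (s k) None].

Definition witnessed (J : {set I}) c (s : 'I_c -> I) (e : V -> N) : Prop :=
  witness_scheme J s /\ exists2 b : 'I_c -> N, injective b &
    forall k i, i \in J \/ i = s k -> Q i (oapp e (b k)).

Lemma witnessed_D J c (s : 'I_c -> I) : D (witnessed J s).
Proof.
have [g|ng] := pselect (witness_scheme J s); last first.
  rewrite (_ : witnessed J s = fun=> False); first exact: (D_false Dc).
  by apply/funext => e; apply/propext; split=> // -[].
have [c0 _ _ _] := g.
rewrite (_ : witnessed J s = fun e => exists2 b : 'I_c -> N, injective b &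
    forall k i, i \in J \/ i = s k -> Q i (oapp e (b k))).
  exact: (@D_exn _ _ _ Dc V c I (fun k i => i \in J \/ i = s k)).
by apply/funext => e; apply/propext; split=> [[]|].
Qed.

(** The conditions on one witness share the quantified variable, so their conjunction projects to a
    mutually algebraic predicate. A mixed [j0] in [J] puts the same free variable [v0] in the scope
    of all [c] projections, so they can be conjoined in turn; hence the nested power. *)
Lemma witnessed_ma J c (s : 'I_c -> I) :
  exists S', ma_on ((K ^ #|I|.+1) ^ c.+1) S' (witnessed J s).
Proof.
have [g|ng] := pselect (witness_scheme J s); last first.
  exists (fun=> False); rewrite (_ : witnessed J s = fun=> False); first exact: ma_on_false.
  by apply/funext => e; apply/propext; split=> // -[].
have [c0 J0 [j0 j0J [Sj0 [v0 Sv0]]] s0] := g.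
have BK (k : 'I_c) : ma_on (K ^ #|I|.+1)
    ((fun v => exists2 i, (i \in J \/ i = s k) & S i v) \o Some)
    (fun e => exists y, (fun e' => forall i, i \in J \/ i = s k -> Q i e') (oapp e y)).
  have := @ma_on_all N K (option V) I (fun i => i \in J \/ i = s k) S Q None.
  move=> /(_ (fun i _ => QS i))/(_ _)/ma_on_some; apply.
  by move=> i [/J0|->].
have [S' HS'] : exists S', S' = (fun v => exists2 k : 'I_c, True &
   ((fun v => exists2 i, (i \in J \/ i = s k) & S i v) \o Some) v).
  by eexists.
exists S'; apply: (@ma_on_sub _ _ _ _ (fun e => forall k : 'I_c, True -> exists y,
   (fun e' => forall i, i \in J \/ i = s k -> Q i e') (oapp e y))).
- move=> e e' ee' [_ [b bI bQ]]; split=> //; exists b => // k i ik.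
  apply: (proj1 (QS i)) (bQ k i ik); case=> //= v Sv; apply: ee'.
  by rewrite HS'; exists k => //=; exists i.
- by move=> e [_ [b _ bQ]] k _; exists (b k) => i; apply: bQ.
rewrite HS'; have -> : c.+1 = #|'I_c|.+1 by rewrite card_ord.
apply: (@ma_on_all _ _ _ _ (fun=> True) _ _ v0) => [k _|k _]; first exact: BK.
by exists j0 => //; left.
Qed.

(** Suppose that every realizer of [J] over [e'] has an extra predicate. Take as many of them as [J]
    has realizers over [e] and transfer them back with their extras: over [e] they exhaust the
    realizers, hence include [y0], which has no extra. *)
Lemma witnessed_exact J e e' y0 :
    (forall c (s : 'I_c -> I), c < K.+1 -> witnessed J s e <-> witnessed J s e') ->
    (forall i, S i None -> Q i (oapp e y0) <-> i \in J) ->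
    (exists2 j, j \in J & mixed j) -> (forall j, j \in J -> S j None) ->
  exists y', forall i, S i None -> Q i (oapp e' y') <-> i \in J.
Proof.
move=> ee' y0J [j0 j0J j0m] JS.
pose A (e : V -> N) (y : {classic N}) := forall i, i \in J -> Q i (oapp e y).
have AK e1 : atmost K (A e1).
  by apply: (atmost_sub (leqnn K)) (@mixed_atmost j0 e1 j0m) => y Ay; apply: Ay.
have exA e1 c (s : 'I_c -> I) (b : 'I_c -> {classic N}) : 0 < c -> injective b ->
    (forall k, A e1 (b k)) -> (forall k, S (s k) None /\ Q (s k) (oapp e1 (b k))) ->
    witnessed J s e1.
  move=> c0 bI bA bs; split; first by split=> // [|k]; [exists j0|case: (bs k)].
  by exists b => // k i [/bA//|->]; case: (bs k).
have [s [us sK sA]] := atmost_list (AK e).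
have y0s : (y0 : {classic N}) \in s by apply/sA => i iJ; apply/(y0J i (JS i iJ)).
have c0 : 0 < size s by case: (s) y0s.
pose b (k : 'I_(size s)) := nth (y0 : {classic N}) s k.
have bI : injective b.
  by move=> k l /eqP; rewrite nth_uniq // => /eqP/val_inj.
have bA k : A e (b k) by apply/sA; rewrite mem_nth.
(* With the constant choice [j0], already in [J], the scheme only says that there are [size s]
   realizers. *)
have exJ : witnessed J (fun _ : 'I_(size s) => j0) e.
  by apply: (exA _ _ _ b) => // k; split; [apply: JS|apply: bA].
move/ee': exJ => /(_ sK)[_ [b' b'I b'J]].
have [y' y'A ny'] : exists2 y', A e' y' & forall i, S i None -> Q i (oapp e' y') -> i \in J.
  apply: contrapT => /forall2NP ny'.
  have /choice[t tP] : forall k, exists i, [/\ S i None, i \notin J & Q i (oapp e' (b' k))].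
    move=> k; case: (ny' (b' k)) => [[]|]; first by move=> i iJ; apply: b'J; left.
    move=> /existsNP[i /not_implyP[Si /not_implyP[Qi /negP iJ]]].
    by exists i.
  have : witnessed J t e'.
    apply: (exA _ _ _ b') => // [k i iJ|k]; first by apply: b'J; left.
    by have [? _ ?] := tP k.
  move/ee' => /(_ sK)[_ [b1 b1I b1J]].
  have [k b1k] : exists k, (b1 k : {classic N}) = y0.
    apply: contrapT => /forallNP nb1.
    suff : size s < size s by rewrite ltnn.
    pose s1 := (y0 : {classic N}) :: [seq (b1 k : {classic N}) | k <- enum 'I_(size s)].
    have s1s : size s1 <= size s.
      apply: uniq_leq_size => [|y] /=.
        rewrite map_inj_uniq // enum_uniq andbT.
        by apply/mapP => -[k _ y0k]; apply: (nb1 k).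
      rewrite inE => /predU1P[->//|/mapP[k _ ->]]; apply/sA => i iJ.
      by apply: b1J; left.
    by rewrite /= size_map size_enum_ord in s1s.
  have [Stk tkJ _] := tP k.
  by case/negP: tkJ; apply/(y0J _ Stk); rewrite -b1k; apply: b1J; right.
exists y' => i Si; split=> [/ny'|/y'A//]; exact.
Qed.

End TameEx.

(** Three families: projections of the [Q i], which settle those not involving the quantified
    variable; witness counts; and the [Q i] with that variable replaced by one of at most [#|I| * K]
    listed values for each pattern. Counts stop at [K], the most values that a mixed predicate
    allows. *)
Definition ex_index (I : finType) (K : nat) : finType :=
  (I + ({set I} * {c : 'I_K.+1 & {ffun 'I_c -> I}}) +
   ({set I} * 'I_(#|I| * K) * I))%type.

Definition ex_bound (I : finType) (K : nat) : nat :=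
  K + \sum_(c < K.+1) (K ^ #|I|.+1) ^ c.+1.

(** Let [J] be the pattern of [y0] over [e]. If it contains a mixed predicate, counting finds the
    pattern over [e']. Otherwise only unary predicates are required: if few values meet them, [y0]
    is a listed parameter and serves again; if many do, one of them avoids the at most [#|I| * K]
    values that realize a mixed predicate over [e']. *)
Lemma tame_ex U (N : structure U) (D : forall V, ((V -> N) -> Prop) -> Prop)
    (I : finType) K V (phi : (option V -> N) -> Prop) :
  closed_definability D -> tame D I K phi ->
  tame D (ex_index I K) (ex_bound I K) (fun e => exists y, phi (oapp e y)).
Proof.
move=> Dc [Q [QSD Qphi]].
have QD i : D _ (Q i) by case: (QSD i).
have /choice[S QS] : forall i, exists S, ma_on K S (Q i) by move=> i; case: (QSD i).
pose unary i := S i None /\ ~ exists v, S i (Some v).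
pose pat (J : {set I}) (y : {classic N}) :=
  forall i, unary i -> Q i (fun=> y) <-> i \in J.
have /choice[lst lstP] : forall J : {set I}, exists l : seq {classic N},
    size l <= #|I| * K /\ (atmost (#|I| * K) (pat J) -> forall y, pat J y -> y \in l).
  move=> J; have [/atmost_list[l [_ lK lJ]]|] := pselect (atmost (#|I| * K) (pat J)).
    by exists l; split=> // _ y /lJ.
  by exists [::].
pose parQ (J : {set I}) (t : 'I_(#|I| * K)) i e :=
  exists2 a, onth (lst J) t = Some a & Q i (oapp e a).
have parE J (t : 'I_(#|I| * K)) i : (exists2 a, onth (lst J) t = Some a &
    parQ J t i = fun e => Q i (oapp e a)) \/ parQ J t i = fun=> False.
  rewrite /parQ; case: (onth (lst J) t) => [a|]; [left; exists a => //|right].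
    by apply/funext => e; apply/propext; split=> [[_ [->]]|]//; exists a.
  by apply/funext => e; apply/propext; split=> [[]|].
pose fam (x : I + ({set I} * {c : 'I_K.+1 & {ffun 'I_c -> I}}) +
    ({set I} * 'I_(#|I| * K) * I)) : (V -> N) -> Prop := match x with
  | inl (inl i) => fun e => exists y, Q i (oapp e y)
  | inl (inr p) => witnessed Q S p.1 (fun k : 'I_(tag p.2) => tagged p.2 k)
  | inr p => parQ p.1.1 p.1.2 p.2 end.
exists fam; split.
  case=> [[i|[J s]]|[[J t] i]].
  - split; last exact: (D_ex Dc).
    by eexists; apply: (ma_on_weaken (leq_addr _ _)); apply: ma_on_some (QS i).
  - split; last exact: witnessed_D.
    have [S' HS'] := witnessed_ma QS J (fun k : 'I_(tag s) => tagged s k); exists S'; apply: ma_on_weaken HS'.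
    by rewrite /ex_bound (bigD1 (tag s)) //= addnCA leq_addr.
  - rewrite (_ : fam _ = parQ J t i) //; have [[a _ ->]|->] := parE J t i; split.
    + by eexists; apply: (ma_on_weaken (leq_addr _ _)); apply: ma_on_param (QS i).
    + exact: (D_param Dc).
    + by exists (fun=> False).
    + exact: (D_false Dc).
move=> e e' ee' [y0 phiy].
suff [y' y'P] : exists y', forall i, Q i (oapp e y0) <-> Q i (oapp e' y').
  by exists y'; apply: Qphi phiy.
pose J := [set i | `[< S i None /\ Q i (oapp e y0) >]].
have y0J i : S i None -> Q i (oapp e y0) <-> i \in J.
  by move=> Si; rewrite inE; split=> [Qi|/asboolP[]//]; apply/asboolP.
suff [y' y'P] : exists y', forall i, S i None -> Q i (oapp e' y') <-> i \in J.
  exists y' => i; have [Si|nSi] := pselect (S i None).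
    by rewrite y0J // y'P.
  have := ee' (inl (inl i)) => /= -[H H']; split=> Qi.
    by have [y Qy] := H (ex_intro _ _ Qi); apply: (no_None_indep QS) Qy.
  by have [y Qy] := H' (ex_intro _ _ Qi); apply: (no_None_indep QS) Qy.
have [mx|nmx] := pselect (exists2 j, j \in J & mixed S j).
  apply: (witnessed_exact QS) y0J mx _ => [c s cK|j]; last by rewrite inE => /asboolP[].
  pose s' : {c : 'I_K.+1 & {ffun 'I_c -> I}} := Tagged (fun c : 'I_K.+1 => {ffun 'I_c -> I})
    ([ffun k => s k] : {ffun 'I_(Ordinal cK) -> I}).
  have := ee' (inl (inr (J, s'))) => /=.
  by rewrite (_ : (fun x => tagged s' x) = s) //; apply/funext => k; rewrite ffunE.
have patE e1 i y : unary i -> Q i (fun=> y) <-> Q i (oapp e1 y).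
  move=> [Si nSi]; have -> : (fun=> y) = oapp (fun=> y) y :> (option V -> N).
    by apply/funext; case.
  by split; apply: (unary_indep QS).
have y0pat : pat J y0 by move=> i ui; rewrite (patE e) // y0J //; case: ui.
have [sm|lg] := pselect (atmost (#|I| * K) (pat J)).
  exists y0 => i Si; rewrite -y0J //.
  have [lK /(_ sm _ y0pat) y0l] := lstP J.
  have tK : index (y0 : {classic N}) (lst J) < #|I| * K.
    by apply: leq_trans lK; rewrite index_mem.
  have := ee' (inr ((J, Ordinal tK), i)); rewrite /= /parQ /=.
  have -> : onth (lst J) (index (y0 : {classic N}) (lst J)) = Some y0.
    by rewrite onthE (nth_map (y0 : {classic N})) ?index_mem // nth_index.
  move=> [H H']; split=> Qi.
    by have [|_ [<-]] := H' _; first by exists y0.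
  by have [|_ [<-]] := H _; first by exists y0.
have bad : atmost (#|I| * K) (fun y : {classic N} =>
    exists i, mixed S i /\ Q i (oapp e' y)).
  apply: atmost_ex => i.
  have [mi|nmi] := pselect (mixed S i).
    have Qi : atmost K (fun y : {classic N} => Q i (oapp e' y)) by apply: (mixed_atmost QS).
    by apply: (atmost_sub (leqnn K)) Qi => y [].
  by apply: (@atmost_cover _ K [::]) => // y [].
have [y' y'J ny'] : exists2 y', pat J y' &
    ~ exists i, mixed S i /\ Q i (oapp e' y').
  apply: contrapT => /forall2NP H; apply: lg.
  by apply: (atmost_sub (leqnn _)) bad => y py; case: (H y) => // /contrapT.
exists y' => i Si; have [[v Sv]|nv] := pselect (exists v, S i (Some v)).
  split=> [Qi|iJ]; first by case: ny'; exists i; split=> //; split=> //; exists v.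
  by case: nmx; exists i => //; split=> //; exists v.
have ui : unary i by split.
by rewrite -(patE e') //; apply: y'J.
Qed.

Section QuantifierElimination.
Variables (U : Type) (I0 : finType) (K0 : nat).

(** The index type and the bound are chosen before the structure, as transductions of whole classes
    require. Colors are unary, so any coloring is mutually algebraic with bound 1. *)
Theorem sat_tame V (phi : form U V) :
  exists (I : finType) (K : nat), forall (N : structure U)
      (D : forall V, ((V -> N) -> Prop) -> Prop),
    closed_definability D ->
    tame D I0 K0 (fun e : 'I_2 -> N => sadj (e ord0) (e ord_max)) ->
    tame D I K (fun e : V -> N => sat phi e).
Proof.
elim: phi => {V} [V x y|V x y|V u x|V p [I [K IH]]|V p [I [K IH]] q [I' [K' IH']]
  |V p [I [K IH]]].
- exists unit, 1 => N D Dc _; apply: (@tame_atom _ _ _ _ _ (fun v => v = x \/ v = y)) => /=.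
    split=> [e e' ee'|v m vxy]; first by rewrite (ee' x) ?(ee' y); [|right|left].
    exists (fun _ _ => m) => e exy ev; exists 0 => // w.
    by case: vxy => vE [] ->; rewrite -ev vE -?exy.
  exact: (D_eq Dc).
- exists I0, K0 => N D Dc.
  by move=> /(tame_map Dc (fun i : 'I_2 => if i == ord0 then x else y)).
- exists unit, 1 => N D Dc _; apply: (@tame_atom _ _ _ _ _ (fun v => v = x)) => /=.
    split=> [e e' ee'|v m ->]; first by rewrite -ee'.
    by exists (fun _ _ => m) => e exy ev; exists 0 => // w ->.
  exact: (D_col Dc).
- by exists I, K => N D Dc H /=; apply: tame_neg; apply: IH.
- by exists (I + I')%type, (maxn K K') => N D Dc H /=; apply: tame_and; [apply: IH|apply: IH'].
- by exists (ex_index I K), (ex_bound I K) => N D Dc H /=; apply: tame_ex => //; apply: IH.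
Qed.

End QuantifierElimination.

(** * Transductions of tame classes *)

Definition edge_tame (I : finType) (K : nat) (M : Type) (E : M -> M -> Prop) : Prop :=
  tame (fun _ _ => True) I K (fun e : 'I_2 -> M => E (e ord0) (e ord_max)).

Definition tame_class (C : graphs) : Prop :=
  exists (I : finType) (K : nat), forall G, C G -> edge_tame I K (fun x y : G => adj x y).

Lemma closed_trivial U (N : structure U) : @closed_definability U N (fun _ _ => True).
Proof. by []. Qed.

Lemma ord2E (i : 'I_2) : i = ord0 \/ i = ord_max.
Proof. by case: i => -[|[|//]] i; [left|right]; apply: val_inj. Qed.

Lemma tnth_pair (M : Type) (e : 'I_2 -> M) : tnth [tuple e ord0; e ord_max] = e.
Proof. by apply/funext => i; case: (ord2E i) => ->; rewrite (tnth_nth (e ord0)). Qed.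

Lemma bounded_degree_tame C : bounded_degree C -> tame_class C.
Proof.
move=> [d Cd]; exists unit, d => G CG.
exists (fun _ e => adj (e ord0) (e ord_max)); split=> [_|e e' /(_ tt)[] //].
split=> //; exists (fun=> True); apply: ma_on_fin => [e e' ee'|v m _].
  by rewrite !ee'.
exists {y | adj m y}, (fun t w => if w == v then m else val t); split.
  by rewrite card_sig; apply: Cd.
move=> e; case: (ord2E v) => -> ae ev.
  have am : adj m (e ord_max) by rewrite -ev.
  by exists (exist (fun y => adj m y) _ am) => w _; case: (ord2E w) => ->.
have am : adj m (e ord0) by rewrite adj_sym -ev.
by exists (exist (fun y => adj m y) _ am) => w _; case: (ord2E w) => ->.
Qed.

(** Edges of the copy are decided by copy indices, the lifted [Q i] and the relation of being copies
    of one vertex. A lift multiplies covers by the [k ^ 2] choices of indices; the last relation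
    leaves [k] choices. *)
Lemma copy_tame (k : nat) (I : finType) (K : nat) (G : sgraph) :
    edge_tame I K (fun x y : G => adj x y) ->
  edge_tame (I + 'I_2 * 'I_k + unit)%type (K * k ^ 2 + k + 1)
    (fun x y : copy k G => adj x y).
Proof.
move=> [Q [QD Qadj]].
exists (fun x => match x with
  | inl (inl i) => fun e => Q i (snd \o e)
  | inl (inr p) => fun e => (e p.1).1 = p.2
  | inr _ => fun e => (e ord0).2 = (e ord_max).2 end); split.
  case=> [[i|[w i]]|_]; split=> //.
  - have [[S [QS QK]] _] := QD i; exists S; apply: ma_on_fin => [e e' ee'|v m Sv].
      by apply: QS => w' /ee' /= ->.
    have [L LQ] := QK v m.2 Sv.
    exists ('I_K * {ffun 'I_2 -> 'I_k})%type,
      (fun (t : 'I_K * {ffun 'I_2 -> 'I_k}) w => (t.2 w, L t.1 w)); split.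
      by rewrite card_prod card_ffun !card_ord -addnA leq_addr.
    move=> e Qe ev; have [|j jK ej] := LQ (snd \o e) Qe; first by rewrite /= ev.
    exists (Ordinal jK, [ffun w => (e w).1]) => w /ej /= <-.
    by rewrite ffunE; case: (e w).
  - exists (fun v => v = w); split=> [e e' ee' /=|v m ->]; first by rewrite ee'.
    exists (fun _ _ => m) => e _ em; exists 0; first by rewrite addn1.
    by move=> w' ->.
  exists (fun=> True); apply: ma_on_fin => [e e' ee'|v m _]; first by rewrite !ee'.
  exists 'I_k, (fun i w => if w == v then m else (i, m.2)); split.
    by rewrite card_ord -addnA addnCA leq_addr.
  move=> e; case: (ord2E v) => -> ee em.
    exists (e ord_max).1 => w _; case: (ord2E w) => -> //=.
    by rewrite -em ee; case: (e ord_max).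
  exists (e ord0).1 => w _; case: (ord2E w) => -> //=.
  by rewrite -em -ee; case: (e ord0).
move=> e e' ee'.
have eb w : (e w).1 = (e' w).1.
  by apply/esym; have [H _] := ee' (inl (inr (w, (e w).1))); apply: H.
rewrite /= /copy_adj !eb; case: eqP => _ /=; rewrite ?orbF.
  by apply: (Qadj (snd \o e) (snd \o e')) => i; apply: (ee' (inl (inl i))).
by move/eqP => /(ee' (inr tt))/eqP.
Qed.

Lemma edge_tame_pull (I : finType) K (M N : Type) (f : M -> N) (E : N -> N -> Prop) :
  injective f -> edge_tame I K E -> edge_tame I K (fun x y => E (f x) (f y)).
Proof.
move=> fI [Q [QD QE]]; exists (fun i e => Q i (f \o e)); split; last first.
  by move=> e e' ee'; apply: (QE (f \o e) (f \o e')).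
move=> i; split=> //; have [[S [QS QK]] _] := QD i; exists S.
split=> [e e' ee'|v m Sv]; first by apply: QS => w' /ee' /= ->.
have /choice[g gf] : forall n, exists m', forall m, f m = n -> m' = m.
  move=> n; have [[m' <-]|nm] := pselect (exists m', f m' = n); last first.
    by exists m => m' fm'; case: nm; exists m'.
  by exists m' => m1 /fI.
have [L LQ] := QK v (f m) Sv; exists (fun i w => g (L i w)) => e Qe ev.
have [|j jK ej] := LQ _ Qe; first by rewrite /= ev.
by exists j => // w /ej /= /gf ->.
Qed.

Lemma transduction_tame C D : tame_class D -> transduction_of C D -> tame_class C.
Proof.
move=> [I [K DK]] [[k k0 U J] CD].
have [I' [K' H]] := @sat_tame U (I + 'I_2 * 'I_k + unit)%type (K * k ^ 2 + k + 1)
  'I_2 (eta J).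
exists I', K' => G /CD[H' /DK/(copy_tame k) tH [/= c [f [g fK gK] fadj]]].
have /(_ (fun _ _ => True)) := H (colored_graph c).
move=> /(_ (closed_trivial _) tH) tJ.
have fI : injective (fun x : G => val (g x)) by move=> x y /val_inj/(can_inj gK).
have tE : edge_tame I' K' (@sat2 U (colored_graph c) (eta J)).
  by apply: tame_ext tJ => e; rewrite /sat2 tnth_pair.
have [Q [QD Qadj]] := edge_tame_pull fI tE.
exists Q; split=> // e e' /Qadj ee'.
have aE x y : adj x y = adj (g x) (g y) by rewrite -fadj !gK.
by rewrite !aE => /asboolP/ee' ?; apply/asboolP.
Qed.

(** * Spread of neighbourhoods in tame classes and in star forests *)

Definition far (M : Type) (E : M -> M -> Prop) (K : nat) : Prop :=
  exists x : 'I_K -> M, forall l l', l != l' ->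
    exists2 b : 'I_K -> M, injective b & forall i, ~ (E (x l) (b i) <-> E (x l') (b i)).

Definition near_covered (C : graphs) : Prop :=
  exists K, forall G, C G -> ~ far (fun x y : G => adj x y) K.

Definition env2 (M : Type) (x y : M) (i : 'I_2) : M := if i == ord0 then x else y.

(** By pigeonhole two of the vertices agree on the predicates in the first variable alone. Where
    their neighbourhoods differ, one of them realizes a predicate involving both variables, which
    happens in at most [2 * #|I| * K] places. *)
Lemma tame_not_far (I : finType) (K : nat) :
  exists K', forall (M : Type) (E : M -> M -> Prop), edge_tame I K E -> ~ far E K'.
Proof.
pose k := #|{set I}| + (#|I| * K + #|I| * K).
exists k.+1 => M E [Q [QD QE]] [x xP].
have /choice[S QS] : forall i, exists S, ma_on K S (Q i) by move=> i; case: (QD i).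
(* The diagonal merely fills the second position: the value is read off only for predicates whose
   scope is the first variable. *)
pose tau l := [set i | `[< Q i (env2 (x l) (x l)) >]].
have [l [l' ll' tl]] : exists l, exists2 l', l != l' & tau l = tau l'.
  apply: contrapT => H; have tI : injective tau.
    move=> l l' tl; apply/eqP/contraT => ll'.
    by case: H; exists l, l'.
  by have := leq_card _ tI; rewrite card_ord leqNgt ltnS leq_addr.
have [b bI bP] := xP l l' ll'.
pose both i := S i ord0 /\ S i ord_max.
have few l1 : atmost (#|I| * K) (fun y : {classic M} => exists i, both i /\ Q i (env2 (x l1) y)).
  apply: atmost_ex => i; have [[S0 S1]|nb] := pselect (both i); last first.
    by apply: (@atmost_cover _ K [::]) => // y [].
  have [L LQ] := proj2 (QS i) ord0 (x l1) S0.
  apply: (@atmost_cover _ K [seq (L j ord_max : {classic M}) | j <- iota 0 K]).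
    by rewrite size_map size_iota.
  move=> y [_ Qy]; have [//|j jK ej] := LQ _ Qy.
  apply/mapP; exists j; first by rewrite mem_iota.
  by rewrite -(ej ord_max S1).
suff dP (y : {classic M}) : ~ (E (x l) y <-> E (x l') y) ->
    (exists i, both i /\ Q i (env2 (x l) y)) \/ (exists i, both i /\ Q i (env2 (x l') y)).
  apply: (@atmost_inj {classic M} k (fun y => ~ (E (x l) y <-> E (x l') y)) b bI bP).
  exact: (atmost_sub (leq_addl _ _) dP (atmost_or (few l) (few l'))).
move=> nE; apply: contrapT => /not_orP[n1 n2]; apply: nE.
have QQ i : Q i (env2 (x l) y) <-> Q i (env2 (x l') y).
  have [bi|nb] := pselect (both i).
    by split=> Qi; [case: n1|case: n2]; exists i.
  have [S0|nS0] := pselect (S i ord0); last first.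
    have ag z z' : agree (S i) (env2 z y) (env2 z' y).
      by move=> v Sv; case: (ord2E v) => vE; rewrite /env2 vE //; rewrite vE in Sv.
    by split; apply: (proj1 (QS i) _ _ (ag _ _)).
  have ag (z y1 y2 : M) : agree (S i) (env2 z y1) (env2 z y2).
    by move=> v Sv; case: (ord2E v) => vE; rewrite /env2 vE //; rewrite vE in Sv; case: nb.
  have: (i \in tau l) = (i \in tau l') by rewrite tl.
  rewrite !inE => tE'.
  have tE : Q i (env2 (x l) (x l)) <-> Q i (env2 (x l') (x l')).
    by split=> /asboolP; [rewrite tE'|rewrite -tE'] => /asboolP.
  have QE' z y1 y2 : Q i (env2 z y1) -> Q i (env2 z y2) := proj1 (QS i) _ _ (ag z y1 y2).
  by split=> /(QE' _ _ _)/tE/(QE' _ _ _).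
split; first exact: (QE (env2 (x l) y) (env2 (x l') y) QQ).
exact: (QE (env2 (x l') y) (env2 (x l) y) (fun i => iff_sym (QQ i))).
Qed.

Section StarForest.
Variable K : nat.
Let V : finType := ('I_K * option 'I_K)%type.
Definition full_star_adj : rel V := fun u v => (u.1 == v.1) && ((u.2 == None) != (v.2 == None)).
Fact full_star_sym : symmetric full_star_adj.
Proof. by move=> u v; rewrite /full_star_adj eq_sym; congr (_ && ~~ _); apply: eq_sym. Qed.
Fact full_star_irrefl : irreflexive full_star_adj.
Proof. by move=> u; rewrite /full_star_adj !eqxx. Qed.
Definition full_star_forest : sgraph := SGraph full_star_sym full_star_irrefl.

(** Every edge joins a center to a leaf and a leaf has a single neighbour, which excludes cycles
    through three or more vertices. *)
Lemma full_star_forest_star : star_forests full_star_forest.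
Proof.
split=> [s /andP[]|x].
  case: s => [|x [|y [|z s]]] //= /and3P[xy yz zs].
  rewrite !inE => /andP[/norP[_ /norP[xz _]] /andP[/norP[yz' ys] _]].
  have ends (u v : V) : full_star_adj u v -> (u.2 == None) = ~~ (v.2 == None).
    by case/andP => _; case: (u.2 == _); case: (v.2 == _).
  have leaf (u v w : V) : v.2 != None -> full_star_adj u v -> full_star_adj v w -> u = w.
    case: u v w => i a [j b] [k c] /= bN /andP[/= /eqP <- ab] /andP[/= /eqP <- bc].
    by case: a b c ab bN bc => [?|] [?|] [?|].
  have [y0|yN] := eqVneq y.2 None; last by rewrite (leaf x y z) ?eqxx in xz.
  have zN : z.2 != None by move: yz; rewrite /full_star_adj y0 => /andP[_]; case: z.2.
  case: s zs ys => [|w s] /= /andP[zw _] ys.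
    by have := ends _ _ zw; have := ends _ _ xy; rewrite y0 /= (negPf zN) => ->.
  by rewrite (leaf y z w) // inE eqxx in ys.
have adjN (u : V) : connect full_star_adj u (u.1, None).
  case: u => i [j|]; last exact: connect0.
  by apply: connect1; rewrite /full_star_adj /= !eqxx.
have con1 u : connect full_star_adj x u -> x.1 = u.1.
  move=> /connectP[p + ->]; elim: p (x) => //= a p IH y /andP[/andP[/eqP -> _] /IH].
  done.
exists (exist _ (x.1, None) (adjN x)) => -[[i a] hi] [[j c] hj].
rewrite /= /induced_adj /= /full_star_adj -!val_eqE /=.
have xi : x.1 = i := con1 _ hi; have xj : x.1 = j := con1 _ hj; subst i j.
rewrite !xpair_eqE !eqxx /=.
by case: a c {hi hj} => [?|] [?|] //=; rewrite ?eqxx ?orbF ?andbF.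
Qed.

Lemma full_star_forest_far : far (fun x y : full_star_forest => adj x y) K.
Proof.
exists (fun l => (l, None)) => l l' ll'.
exists (fun i => (l, Some i)) => [i j []//|i].
rewrite /= /full_star_adj /= !eqxx [l' == l]eq_sym (negPf ll') /=.
by case=> H _; have := H isT.
Qed.
End StarForest.

Lemma star_forests_far : ~ near_covered star_forests.
Proof.
by move=> [K /(_ _ (full_star_forest_star K))]; apply; apply: full_star_forest_far.
Qed.

(** * Noncopying transductions and perturbations *)

Lemma noncopying_transduction C D :
  noncopying_transduction_of C D -> transduction_of C D.
Proof. by move=> [T _ CT]; exists T. Qed.

Definition swap2 (i : 'I_2) : 'I_2 := if i == ord0 then ord_max else ord0.

Lemma sat2_swap U (M : structure U) (phi : form U 'I_2) (x y : M) :
  sat2 (form_map swap2 phi) x y <-> sat2 phi y x.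
Proof.
rewrite /sat2 sat_map (_ : _ \o _ = tnth [tuple y; x]) //.
by apply/funext => i; case: (ord2E i) => ->.
Qed.

(** An [interpretation] must be symmetric and irreflexive on every colored graph, not only on the
    intended ones, so both properties are forced syntactically. *)
Definition symmetrized U (phi : form U 'I_2) : form U 'I_2 :=
  And (Neg (Eq U ord0 ord_max)) (Or phi (form_map swap2 phi)).

Lemma sat2_symmetrized U (M : structure U) (phi : form U 'I_2) (x y : M) :
  sat2 (symmetrized phi) x y <-> x <> y /\ (sat2 phi x y \/ sat2 phi y x).
Proof. by rewrite -[sat2 phi y x]sat2_swap /sat2 -sat_Or. Qed.

Fact symmetrized_sym U (phi : form U 'I_2) (G : sgraph) (c : coloring U G)
    (x y : colored_graph c) :
  sat2 (symmetrized phi) x y -> sat2 (symmetrized phi) y x.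
Proof.
by move=> /sat2_symmetrized[xy pxy]; apply/sat2_symmetrized; split; [move=> /esym|tauto].
Qed.

Fact symmetrized_irrefl U (phi : form U 'I_2) (G : sgraph) (c : coloring U G)
    (x : colored_graph c) : ~ sat2 (symmetrized phi) x x.
Proof. by move=> /sat2_symmetrized[]. Qed.

(* The color u0 marks the vertices of H inside G. *)
Lemma interpretable_transduction U (u0 : U) (phi : form U 'I_2) (C D : graphs) :
    (forall H, C H -> exists2 G : sgraph, D G &
      exists (c : coloring U G) (f : H -> G),
      [/\ injective f, forall z, c u0 z <-> exists x, f x = z
        & forall x y, adj x y <-> x <> y /\
          (@sat2 U (colored_graph c) phi (f x) (f y) \/
           @sat2 U (colored_graph c) phi (f y) (f x))]) ->
  noncopying_transduction_of C D.
Proof.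
move=> HCD; pose J := Interpretation (Col u0 ord0)
  (@symmetrized_sym U phi) (@symmetrized_irrefl U phi).
pose T := Transduction (copies := 1) isT J.
exists T; first by exists T.
move=> H /HCD[G DG [c [f [fI fc fadj]]]]; exists G => //=.
pose c' : coloring U (copy 1 G) := fun u p => c u p.2.
exists c'.
have sndK : cancel (snd : copy 1 G -> G) (fun x => (ord0, x)).
  by move=> [i x]; rewrite (ord1 i).
have isoc V (psi : form U V) (e : V -> colored_graph c') :
    sat psi e <-> @sat U (colored_graph c) V psi (snd \o e).
  apply: (@sat_iso U (colored_graph c') (colored_graph c) snd (fun x => (ord0, x))) => //.
  by move=> [i x] [j y]; rewrite /= /copy_adj /= (ord1 i) (ord1 j) /= orbF.
have sE p q : @sat2 U (colored_graph c') phi p q <-> @sat2 U (colored_graph c) phi p.2 q.2.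
  rewrite /sat2 isoc (_ : snd \o _ = tnth [tuple p.2; q.2]) //.
  by apply/funext => i; case: (ord2E i) => ->.
have vP x : interpret_vertex J c' (ord0, f x).
  by apply/asboolP; rewrite /sat1 /=; apply/fc; exists x.
pose g x : interpret J c' := exist _ (ord0, f x) (vP x).
have /choice[h hP] : forall p : interpret J c', exists x, f x = (val p).2.
  by move=> [p] /= /asboolP; rewrite /sat1 /= => /fc.
have gh p : g (h p) = p by apply: val_inj; rewrite /= hP sndK.
have hg x : h (g x) = x by apply: fI; rewrite hP.
exists h; first by exists g.
move=> p q; rewrite /= /interpret_adj; apply/idP/asboolP.
  move=> /fadj[hpq H1]; apply/sat2_symmetrized; split.
    by move=> /val_inj pq; case: hpq; rewrite pq.
  by move: H1; rewrite !hP !sE.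
move=> /sat2_symmetrized[pq H1]; apply/fadj; split.
  by move=> hpq; apply: pq; rewrite -(gh p) hpq gh.
by move: H1; rewrite !hP !sE.
Qed.

Lemma graph_iso_trans G H K : graph_iso G H -> graph_iso H K -> graph_iso G K.
Proof.
move=> [f fb fadj] [g gb gadj]; exists (g \o f); first exact: bij_comp.
by move=> x y; rewrite /= gadj fadj.
Qed.

Lemma graph_iso_sym G H : graph_iso G H -> graph_iso H G.
Proof.
move=> [f [g fK gK] fadj]; exists g; first by exists f.
by move=> x y; rewrite -fadj !gK.
Qed.

Section Xflip.
Variables (G : sgraph) (As : seq (pred G)).
(** Subset complementations commute: only the parity of the number of chosen sets containing both
    ends matters. This gives an order-free form of [perturb]. *)
Definition parity (x y : G) : bool := \big[addb/false]_(A <- As) (A x && A y).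
Definition xflip_adj : rel G := fun x y => adj x y (+) ((x != y) && parity x y).
Fact parity_sym : symmetric parity.
Proof. by move=> x y; apply: eq_bigr => A _; rewrite andbC. Qed.
Fact xflip_sym : symmetric xflip_adj.
Proof. by move=> x y; rewrite /xflip_adj adj_sym eq_sym parity_sym. Qed.
Fact xflip_irrefl : irreflexive xflip_adj.
Proof. by move=> x; rewrite /xflip_adj adj_irrefl eqxx. Qed.
Definition xflip : sgraph := SGraph xflip_sym xflip_irrefl.
End Xflip.

Lemma subset_complementE (G : sgraph) (A : pred G) (x y : G) :
  compl_adj A x y = adj x y (+) ((x != y) && (A x && A y)).
Proof.
by rewrite /compl_adj; case: (A x); case: (A y); case: (x != y) => //=; rewrite ?addbT ?addbF.
Qed.

Lemma xflip_cons (G : sgraph) (A : pred G) (As : seq (pred G)) (x y : G) :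
  @adj (@xflip (subset_complement A) As) x y = @adj (xflip (A :: As)) x y.
Proof.
rewrite /= /xflip_adj /= subset_complementE /parity big_cons -addbA; congr (_ (+) _).
by case: (x != y).
Qed.

Lemma perturb_iso p G H H' : perturb p G H -> graph_iso H H' -> perturb p G H'.
Proof.
elim: p G => [|p IH] G /=; first exact: graph_iso_trans.
by move=> [A GH] HH'; exists A; apply: IH HH'.
Qed.

Lemma perturb_xflip (G : sgraph) (As : seq (pred G)) : perturb (size As) G (xflip As).
Proof.
move: {2}(size As) (erefl (size As)) => p; elim: p => [|p IH] in G As *.
  move=> /size0nil ->; exists id; first by exists id.
  by move=> x y; rewrite /= /xflip_adj /parity big_nil andbF addbF.
case: As => // A As [Asp] /=; exists A.
apply: perturb_iso (IH (subset_complement A) As Asp) _.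
exists id; first by exists id.
by move=> x y; rewrite -xflip_cons.
Qed.

Lemma xflip_perturb p G H : perturb p G H ->
  exists2 As : seq (pred G), size As = p & graph_iso (xflip As) H.
Proof.
elim: p G => [|p IH] G /=.
  move=> GH; exists [::] => //; apply: graph_iso_trans GH.
  exists id; first by exists id.
  by move=> x y; rewrite /= /xflip_adj /parity big_nil andbF addbF.
move=> [A /IH[As Asp GH]]; exists (A :: As); first by rewrite /= Asp.
apply: graph_iso_trans GH; exists id; first by exists id.
by move=> x y; rewrite xflip_cons.
Qed.

Definition flip_form U (u : nat -> U) (phi : form U 'I_2) (p : nat) : form U 'I_2 :=
  foldr (fun i psi => Neg (Iff (And (Col (u i) ord0) (Col (u i) ord_max)) psi)) phi (iota 0 p).

Lemma sat2_flip U (c : U) (psi : form U 'I_2) (M : structure U) (x y : M) :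
  sat2 (Neg (Iff (And (Col c ord0) (Col c ord_max)) psi)) x y <->
  ~ (scol c x /\ scol c y <-> sat2 psi x y).
Proof.
have E := sat_Iff (And (Col c ord0) (Col c ord_max)) psi (tnth [tuple x; y]).
by split=> H1 H2; [exact: H1 (proj2 E H2)|exact: H1 (proj1 E H2)].
Qed.

Lemma sat2_flip_form U (u : nat -> U) (phi : form U 'I_2) (M : structure U)
    (x y : M) (b : bool) (a a' : nat -> bool) p :
    (forall i, i < p -> scol (u i) x <-> a i) -> (forall i, i < p -> scol (u i) y <-> a' i) ->
    (sat2 phi x y <-> b) ->
  sat2 (flip_form u phi p) x y <-> b (+) \big[addb/false]_(0 <= i < p) (a i && a' i).
Proof.
move=> xa ya xyb; rewrite /flip_form /index_iota subn0.
have : forall i, i \in iota 0 p -> i < p by move=> i; rewrite mem_iota.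
elim: (iota 0 p) => [|i s IH] sp /=; first by rewrite big_nil addbF.
rewrite big_cons addbCA sat2_flip IH; last by move=> j js; apply: sp; rewrite inE js orbT.
have ip : i < p by apply: sp; rewrite inE eqxx.
rewrite (xa i ip) (ya i ip).
by case: (a i); case: (a' i); case: (b (+) _) => /=; clear; intuition congruence.
Qed.

(** * Coding bounded degree graphs in cubic graphs *)

(* Each vertex v of G becomes two disjoint cycles (b, v, 0), ..., (b, v, K - 1),
   K = 3(d+1). The a-th edge of v is attached at position 3a, so that matching
   edges join positions divisible by 3; an unused position is matched with its
   twin on the other cycle. *)
Section CubicHost.
Variables (d : nat) (G : sgraph).
Hypothesis Gd : forall x : G, degree x <= d.

Let K := (3 * d).+3.
Definition host_vertex : finType := (bool * G * 'I_K)%type.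
Definition nbrs (v : G) : seq G := enum [pred w | adj v w].

Lemma index_nbrs v w : adj v w -> index w (nbrs v) < d.
Proof.
move=> vw; apply: leq_trans (Gd v); rewrite /degree cardE.
by rewrite index_mem mem_enum.
Qed.

Definition port (v w : G) : 'I_K := inord (3 * index w (nbrs v)).

Lemma portE v w : adj v w -> port v w = 3 * index w (nbrs v) :> nat.
Proof.
move=> /index_nbrs id; rewrite /port inordK //.
by rewrite ltnS (leq_trans _ (leqnSn _)) // (leq_trans _ (leqnSn _)) // leq_mul2l ltnW.
Qed.

Definition partner (u : host_vertex) : host_vertex :=
  if [pick w | adj u.1.2 w && (port u.1.2 w == u.2)] is Some w
  then (u.1.1, w, port w u.1.2) else (~~ u.1.1, u.1.2, u.2).

Lemma port_inj v w w' : adj v w -> adj v w' -> port v w = port v w' -> w = w'.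
Proof.
move=> vw vw' /(congr1 val); rewrite /= !portE // => /eqP; rewrite eqn_pmul2l // => /eqP ii.
have mw : w \in nbrs v by rewrite mem_enum.
by rewrite -(nth_index w mw) ii nth_index // mem_enum.
Qed.

Lemma partner_port b v w : adj v w -> partner (b, v, port v w) = (b, w, port w v).
Proof.
move=> vw; rewrite /partner /=; case: pickP => [w' /andP[vw' /eqP /port_inj <-]//|/(_ w)].
by rewrite vw eqxx.
Qed.

Lemma partnerK : involutive partner.
Proof.
move=> [[b v] i]; rewrite {2}/partner /=; case: pickP => [w /andP[vw /eqP <-]|nw].
  by rewrite partner_port // adj_sym.
rewrite /partner /=; case: pickP => [w|_]; first by rewrite nw.
by rewrite negbK.
Qed.

(** The partner lies on another cycle, so the matching edge is distinct from both cycle edges and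
    the degree is exactly 3. *)
Lemma partner_neq u : (partner u).1 != u.1.
Proof.
case: u => [[b v] i]; rewrite /partner /=; case: pickP => [w /andP[vw _]|_].
  apply/eqP => -[wv]; by rewrite wv adj_irrefl in vw.
by apply/eqP => -[]; case: b.
Qed.

Definition host_adj : rel host_vertex := fun u v =>
  ((u.1 == v.1) && ((ordS u.2 == v.2) || (ordS v.2 == u.2))) || (partner u == v).

Fact host_sym : symmetric host_adj.
Proof.
move=> u v; rewrite /host_adj (can2_eq partnerK partnerK) [u == _]eq_sym.
by rewrite [u.1 == _]eq_sym [(ordS u.2 == _) || _]orbC.
Qed.

Lemma ordS_neq (i : 'I_K) : ordS i != i.
Proof.
apply/eqP => /(congr1 val) /=; case: i => i /=.
rewrite leq_eqVlt => /predU1P[iK|iK].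
  by rewrite iK modnn => i0; rewrite -i0 in iK.
by rewrite modn_small // => /eqP; rewrite eqn_leq ltnn.
Qed.

(** Successor and predecessor on a cycle differ because its length is at least 3, even for
    [d = 0]. *)
Lemma ordS2_neq (i : 'I_K) : ordS (ordS i) != i.
Proof.
apply/eqP => /(congr1 val) /=; rewrite -[(_ %% _).+1]addn1 modnDml addn1.
case: i => i /=; rewrite leq_eqVlt => /predU1P[iK|].
  by rewrite -add1n iK modnDr modn_small // => i1; rewrite -i1 in iK.
rewrite leq_eqVlt => /predU1P[iK|iK].
  by rewrite iK modnn => i0; rewrite -i0 in iK.
by rewrite modn_small // => /eqP; rewrite eqn_leq [_.+2 <= _]leqNgt ltnS leqnSn.
Qed.

Fact host_irrefl : irreflexive host_adj.
Proof.
move=> u; rewrite /host_adj eqxx orbb (negPf (ordS_neq _)) /=.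
by apply/eqP => uu; have := partner_neq u; rewrite uu eqxx.
Qed.

Definition host : sgraph := SGraph host_sym host_irrefl.

Lemma host_cubic : cubic_graphs host.
Proof.
move=> u; rewrite /degree.
have -> : 3 = size [:: (u.1, ordS u.2); (u.1, ord_pred u.2); partner u] by [].
rewrite -(@card_uniqP host_vertex [:: (u.1, ordS u.2); (u.1, ord_pred u.2); partner u] _).
  apply: eq_card => v; rewrite !inE /= /host_adj orbA [partner u == v]eq_sym.
  congr (_ || _); case: u v => [p i] [q j] /=; rewrite !xpair_eqE.
  rewrite [q == p]eq_sym; case: (p == q) => //=.
  rewrite [j == _]eq_sym [j == ord_pred i]eq_sym; congr (_ || _).
  by apply/eqP/eqP => [<-|<-]; rewrite ?ordSK ?ord_predK.
rewrite /= !inE !negb_or !xpair_eqE eqxx /= andbT. rewrite -andbA; apply/and3P; split.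
- by apply/eqP => ii; have := ordS2_neq (ord_pred u.2); rewrite ord_predK ii eqxx.
- by apply/eqP => ii; have := partner_neq u; rewrite -ii eqxx.
- by apply/eqP => ii; have := partner_neq u; rewrite -ii eqxx.
Qed.

End CubicHost.

Lemma sat2_map U (M : structure U) V (phi : form U 'I_2) (h : 'I_2 -> V) (e : V -> M) :
  sat (form_map h phi) e <-> sat2 phi (e (h ord0)) (e (h ord_max)).
Proof. by rewrite sat_map /sat2 -(tnth_pair (e \o h)). Qed.

Section Walk.
Variables (U : Type) (u : nat -> U).

(** The host has neither orientation nor names for its ports: following the colors 0, ..., [j] from
    the base vertex is what singles out position [j] on its cycle. *)
Fixpoint walk (j : nat) : form U 'I_2 :=
  if j is j'.+1 then
    Ex (And (form_map (env2 (Some ord0) None) (walk j'))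
      (And (Adj U None (Some ord_max))
        (And (Col (u j') None) (Col (u j) (Some ord_max)))))
  else And (Eq U ord0 ord_max) (Col (u 0) ord0).

Definition edge_walk (i j : nat) : form U 'I_2 :=
  Ex (Ex (And (form_map (env2 (Some (Some ord0)) (Some None)) (walk i))
    (And (form_map (env2 (Some (Some ord_max)) None) (walk j))
      (Adj U (Some None) None)))).

Definition port_form (d : nat) : form U 'I_2 :=
  Exf ord0 (fun p : 'I_d * 'I_d => edge_walk (3 * p.1) (3 * p.2)).

Lemma sat2_walk0 (M : structure U) (x y : M) :
  sat2 (walk 0) x y <-> x = y /\ scol (u 0) x.
Proof. by []. Qed.

Lemma sat2_walkS j (M : structure U) (x y : M) :
  sat2 (walk j.+1) x y <->
  exists z, [/\ sat2 (walk j) x z, sadj z y, scol (u j) z & scol (u j.+1) y].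
Proof.
rewrite {1}/sat2 /=; split=> -[z].
  by rewrite sat2_map => -[? [? [? ?]]]; exists z.
by case=> ? ? ? ?; exists z; rewrite sat2_map.
Qed.

Lemma sat2_port_form d (M : structure U) (x y : M) :
  sat2 (port_form d) x y <-> exists (i j : 'I_d) (z t : M),
    [/\ sat2 (walk (3 * i)) x z, sat2 (walk (3 * j)) y t & sadj z t].
Proof.
rewrite /sat2 sat_Exf; split.
  move=> [[i j]] /= [z [t]]; rewrite !sat2_map => -[? [? ?]].
  by exists i, j, z, t.
move=> [i [j [z [t [? ? ?]]]]]; exists (i, j) => /=; exists z, t.
by rewrite !sat2_map.
Qed.

(** Only the colors [u i] are prescribed, which leaves the others free to mark vertices and
    flips. *)
Lemma cubic_coding (d : nat) (G : sgraph) : (forall x : G, degree x <= d) ->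
  exists (H : sgraph) (c0 : nat -> pred H) (f : G -> H),
  [/\ cubic_graphs H, injective f &
    forall c : coloring U H, (forall i z, c (u i) z = c0 i z) ->
    forall x y, x <> y -> @sat2 U (colored_graph c) (port_form d) (f x) (f y) <-> adj x y].
Proof.
move=> Gd; exists (host Gd); exists (fun i (z : host_vertex d G) => z.1.1 && (z.2 == i :> nat)).
exists (fun v => (true, v, ord0)); split; first exact: host_cubic.
  by move=> v w [].
move=> c cE x y xy.
(* A step from color [j] to color [j.+1] cannot use a matching edge, since such an edge either
   leaves the marked cycles or joins two positions divisible by 3. *)
have walkE v j z : j < (3 * d).+3 ->
    @sat2 U (colored_graph c) (walk j) (true, v, ord0) z <-> z = (true, v, inord j).
  elim: j z => [|j IH] z jK.
    rewrite sat2_walk0 /= cE /= (_ : inord 0 = ord0) //; last by apply: val_inj; rewrite /= inordK.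
    by split=> [[<-]|->].
  rewrite sat2_walkS; split=> [[t [/(IH _ (ltnW jK)) -> tz _]]|->]; last first.
    exists (true, v, inord j); split=> /=; rewrite ?cE ?IH //= ?inordK // ?(ltnW jK) //.
    rewrite /host_adj /= eqxx (_ : ordS _ == _) //.
    by apply/eqP/val_inj; rewrite /= !inordK // ?modn_small // ltnW.
  rewrite /= cE => /andP[z1 /eqP zj].
  move: tz; rewrite /host_adj /= => /orP[/andP[/eqP zE _]|/eqP].
    by rewrite (surjective_pairing z) -zE -zj inord_val.
  rewrite /partner /=; case: pickP => [w /andP[vw /eqP vwj]|_] zE; last by rewrite -zE in z1.
  exfalso.
  move: (congr1 val vwj) zj; rewrite -zE /= !portE // 1?adj_sym // inordK ?(ltnW jK) //.
  by move=> <- /(congr1 (modn^~ 3)); rewrite -[(3 * _).+1]addn1 -modnDml !modnMr.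
rewrite sat2_port_form; split; last first.
  move=> xy'; have dx := index_nbrs Gd xy'.
  have yx' : adj y x by rewrite adj_sym.
  have dy := index_nbrs Gd yx'.
  have K3 i : i < d -> 3 * i < (3 * d).+3.
    by move=> id; rewrite !ltnS !(leqW _) // leq_mul2l ltnW.
  exists (Ordinal dx), (Ordinal dy), (true, x, @port d G x y), (true, y, @port d G y x).
  split; [by apply/walkE => //; apply: K3|by apply/walkE => //; apply: K3|].
  by rewrite /= /host_adj partner_port // eqxx orbT.
move=> [i [j [z [t []]]]].
have K3 (l : 'I_d) : 3 * l < (3 * d).+3.
  by rewrite !ltnS !(leqW _) // leq_mul2l ltnW.
move=> /(walkE _ _ _ (K3 i)) -> /(walkE _ _ _ (K3 j)) ->; rewrite /= /host_adj /= => /orP[/andP[/eqP[]]//|/eqP].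
by rewrite /partner /=; case: pickP => [w /andP[xw _] [<-]|//].
Qed.
End Walk.

Section FlippedCoding.
Let color := option (nat + nat).
Definition code_color i : color := Some (inl i).
Definition flip_color i : color := Some (inr i).

(** The flips act on the decoded adjacency and not on the host, so [L] may be unrelated in shape to
    [G]: a cubic graph, or [G] itself with [phi] the plain adjacency. *)
Lemma flipped_coding_transduction (phi : form color 'I_2) p (C E : graphs) :
    (forall H, C H -> exists (G : sgraph) (As : seq (pred G)) (L : sgraph)
      (c0 : nat -> pred L) (f : G -> L),
      [/\ size As = p, graph_iso (xflip As) H, E L, injective f &
        forall c : coloring color L, (forall i z, c (code_color i) z = c0 i z) ->
        forall x y, x <> y -> @sat2 _ (colored_graph c) phi (f x) (f y) <-> adj x y]) ->
  noncopying_transduction_of C E.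
Proof.
move=> HC; apply: (@interpretable_transduction _ None (flip_form flip_color phi p)) => H.
move=> /HC[G [As [L [c0 [f [Asp [h [g hK gK] hadj] EL fI fP]]]]]].
exists L => //.
pose c : coloring color L := fun u z => match u with
  | Some (inl i) => c0 i z
  | Some (inr i) => [exists x : G, (f x == z) && nth (xpred0 : pred G) As i x]
  | None => [exists x : H, f (g x) == z] end.
exists c, (f \o g); split.
- by apply: inj_comp fI (can_inj gK).
- move=> z; split=> [/existsP[x /eqP]|[x]]; first by exists x.
  by move=> /eqP xz; apply/existsP; exists x.
have cA i x : c (flip_color i) (f x) <-> nth (xpred0 : pred G) As i x.
  split=> [/existsP[y /andP[/eqP/fI -> //]]|xA]; apply/existsP; exists x.
  by rewrite eqxx.
have satE x y : x <> y -> @sat2 _ (colored_graph c)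
    (flip_form flip_color phi p) (f (g x)) (f (g y)) <-> adj x y.
  move=> xy; have gxy : g x <> g y by move=> /(can_inj gK).
  rewrite (sat2_flip_form (b := @adj G (g x) (g y)) (a := fun i => nth (xpred0 : pred G) As i (g x))
    (a' := fun i => nth (xpred0 : pred G) As i (g y))).
  - have := hadj (g x) (g y); rewrite !gK => ->; rewrite /= /xflip_adj /parity (introN eqP gxy) /=.
    by rewrite [\big[_/_]_(A <- As) _](big_nth (xpred0 : pred G)) Asp; split.
  - by move=> i _; apply: cA.
  - by move=> i _; apply: cA.
  - exact: fP.
move=> x y; split=> [axy|[xy [/(satE _ _ xy)//|/satE]]].
  have xy : x <> y by move=> xy; move: axy; rewrite xy adj_irrefl.
  by split=> //; left; apply/satE.
by rewrite adj_sym; apply=> /esym.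
Qed.

End FlippedCoding.

Lemma perturbation_cubic C D : bounded_degree D -> perturbation_of C D ->
  noncopying_transduction_of C cubic_graphs.
Proof.
move=> [d Dd] [p CD].
apply: (@flipped_coding_transduction (port_form code_color d) p) => H.
move=> /CD[G /Dd Gd] /xflip_perturb[As Asp GH].
have [L [c0 [f [Lcub fI fP]]]] := cubic_coding code_color Gd.
by exists G, As, L, c0, f.
Qed.

Lemma xflip_transduction p C D :
    (forall H, C H -> exists (G : sgraph) (As : seq (pred G)),
      [/\ size As = p, graph_iso (xflip As) H & D G]) ->
  noncopying_transduction_of C D.
Proof.
move=> HC; apply: (@flipped_coding_transduction (Adj _ ord0 ord_max) p) => H.
by move=> /HC[G [As [Asp GH DG]]]; exists G, As, G, (fun _ => pred0), id; split.
Qed.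

(** * Cells of near-twins *)

(** Double counting: among the [n * n] entries, at most [n * k] satisfy [W] and at most [n * k] do
    not. *)
Lemma grid_bound (n k : nat) (W : rel 'I_n) :
    (forall i, #|[pred j | W i j]| <= k) -> (forall j, #|[pred i | ~~ W i j]| <= k) ->
  n <= k + k.
Proof.
move=> Wr Wc; have [->//|n0] := posnP n; rewrite -(leq_pmul2l n0) mulnDr.
have sumC (F : 'I_n -> nat) : (forall i, F i <= k) -> \sum_i F i <= n * k.
  move=> Fk; have -> : n * k = \sum_(i < n) k by rewrite sum_nat_const card_ord.
  exact: leq_sum.
apply: leq_trans (leq_add (sumC _ Wr) (sumC _ Wc)).
have -> : \sum_(j < n) #|[pred i | ~~ W i j]| = \sum_(i < n) #|[pred j | ~~ W i j]|.
  under eq_bigr do rewrite -sum1_card big_mkcond /=.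
  by rewrite exchange_big /=; apply: eq_bigr => i _; rewrite -sum1_card [RHS]big_mkcond.
rewrite -big_split /=.
have -> : n * n = \sum_(i < n) n by rewrite sum_nat_const card_ord.
apply: leq_sum => i _.
by rewrite -{1}(card_ord n) -(cardC [pred j | W i j]).
Qed.

Lemma atmost_card (M : eqType) k (P : M -> Prop) n (f : 'I_n -> M) (p : pred 'I_n) :
  atmost k P -> injective f -> (forall j, p j -> P (f j)) -> #|p| <= k.
Proof.
move=> Pk fI pP; rewrite cardE -(size_map f); apply: Pk => [|x /mapP[j]].
  by rewrite map_inj_uniq ?enum_uniq.
by rewrite mem_enum => /pP + ->.
Qed.

Section NearCovered.
Variables (M : eqType) (E : M -> M -> Prop) (K : nat).
Hypothesis Esym : forall x y, E x y -> E y x.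

Definition differ (x y z : M) : Prop := ~ (E x z <-> E y z).
Definition twins (x y : M) : Prop := atmost K (differ x y).

Lemma differ_sym x y z : differ x y z -> differ y x z.
Proof. by rewrite /differ => nxy yx; apply: nxy; apply: iff_sym. Qed.

Lemma twins_sym x y : twins x y -> twins y x.
Proof. by apply: (atmost_sub (leqnn K)) => z; apply: differ_sym. Qed.

(** A maximal family of pairwise non-twins covers everything, and [K.+1] of them would be far. *)
Lemma not_far_twins : ~ far E K.+1 ->
  exists s : seq M, size s <= K /\ forall x, exists2 a, a \in s & twins x a.
Proof.
move=> nfar; pose r x y := `[< ~ twins x y >].
have rsym : symmetric r by move=> x y; apply/asbool_equiv_eq; split=> n /twins_sym/n.
pose q n := `[< exists s, pairwise r s /\ size s = n >].
have q0 : exists n, q n by exists 0; apply/asboolP; exists [::].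
have qK n : q n -> n <= K.
  move=> /asboolP[s [rs sn]]; rewrite leqNgt; apply/negP => Kn; apply: nfar.
  case: s rs sn => [_ sn|x0 s rs sn]; first by rewrite -sn in Kn.
  have nthr (l l' : 'I_K.+1) : l < l' -> r (nth x0 (x0 :: s) l) (nth x0 (x0 :: s) l').
    move=> ll'; apply: (pairwiseP x0 rs) => //; rewrite inE sn.
      exact: leq_trans (ltn_ord l) _.
    exact: leq_trans (ltn_ord l') _.
  exists (fun l => nth x0 (x0 :: s) l) => l l' ll'.
  apply: (@not_atmost M K (differ (nth x0 (x0 :: s) l) (nth x0 (x0 :: s) l'))); apply/asboolP.
  by move: ll'; rewrite neq_ltn => /orP[/nthr//|/nthr]; rewrite rsym.
case: (ex_maxnP q0 qK) => n /asboolP[s [rs sn]] nmax.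
exists s; split=> [|x]; first by rewrite sn; apply: qK; apply/asboolP; exists s.
apply: contrapT => /forall2NP nx.
suff : n < n by rewrite ltnn.
apply: nmax; apply/asboolP; exists (x :: s); rewrite /= sn rs andbT; split=> //.
by apply/allP => a as_; apply/asboolP; case: (nx a).
Qed.

Variables (a : 'I_K -> M).
Hypothesis aP : forall x, exists i, twins x (a i).

Definition twins_code (x : M) : {ffun 'I_K -> bool} := [ffun i => `[< twins x (a i) >]].
(** Picking one representative makes the cells disjoint; doing so from the bit vector makes the cell
    a function of the finite code. *)
Definition cell_of (c : {ffun 'I_K -> bool}) : option 'I_K := [pick i | c i].
Definition cell (l : 'I_K) (x : M) : Prop := cell_of (twins_code x) = Some l.

Lemma cell_ex x : exists l, cell l x.
Proof.
rewrite /cell /cell_of; case: pickP => [l _|nl]; first by exists l.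
by have [i xi] := aP x; have := nl i; rewrite ffunE => /asboolP.
Qed.

Lemma cell_twins l x : cell l x -> twins x (a l).
Proof. by rewrite /cell /cell_of; case: pickP => // i + [<-]; rewrite ffunE => /asboolP. Qed.

Let K0 := K + K.

Lemma cell_differ l x y : cell l x -> cell l y -> atmost K0 (differ x y).
Proof.
move=> /cell_twins xl /cell_twins/twins_sym yl.
apply: (atmost_sub (leqnn _)) (atmost_or xl yl) => z xyz.
by apply: contrapT => /not_orP[/contrapT xz /contrapT yz]; apply: xyz; rewrite xz.
Qed.

Let k := 4 * K0 + K0.

Definition sparse (v : Prop) l m : Prop :=
  forall x, cell l x -> atmost k (fun y => cell m y /\ (E x y <-> v)).
Definition small l : Prop := atmost (k + k) (cell l).

(** Otherwise [X ord0] has more than [4 * K0] neighbours [Y j] and as many non-neighbours [Z j] in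
    the cell [m]. The near-twins [Y j] and [Z j] are told apart by at most [K0] vertices of [l],
    while each vertex of [l], a near-twin of [X ord0], tells apart all but [2 * K0] of the pairs;
    [grid_bound] caps such an array at side [4 * K0]. *)
Lemma large_sparse l m : ~ small l -> sparse True l m \/ sparse False l m.
Proof.
move=> /not_atmost[X XI Xl].
(* One vertex decides for its whole cell: the others differ from it in at most [K0] places, the
   slack between [4 * K0] and [k]. *)
suff spv v : atmost (4 * K0) (fun y => cell m y /\ (E (X ord0) y <-> v)) -> sparse v l m.
  apply: contrapT => /not_orP[/(contra_not (@spv _)) nT /(contra_not (@spv _)) nF].
  have [Y YI Ym] := not_atmost nT; have [Z ZI Zm] := not_atmost nF.
  have nB : (4 * K0).+1 <= (k + k).+1 by rewrite ltnS /k -addnA leq_addr.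
  pose X' i := X (widen_ord nB i).
  have X'I : injective X' by move=> i j /XI/(congr1 val)/= /val_inj.
  pose W : rel 'I_(4 * K0).+1 := fun j i => `[< E (X' i) (Y j) /\ ~ E (X' i) (Z j) >].
  suff : (4 * K0).+1 <= (K0 + K0) + (K0 + K0).
    by rewrite ltnNge !addnn -!muln2 -mulnA mulnC leqnn.
  apply: (@grid_bound _ _ W) => [j|i].
    apply: leq_trans (leq_addr K0 K0).
    apply: (atmost_card (cell_differ (Ym j).1 (Zm j).1) X'I) => i /asboolP[XY XZ].
    by rewrite /differ => H; apply: XZ; apply: Esym; apply/H; apply: Esym.
  apply: (@leq_trans (#|[pred j | ~~ `[< E (X' i) (Y j) >]]| + #|[pred j | `[< E (X' i) (Z j) >]]|)).
    rewrite -cardUI; apply: leq_trans (leq_addr _ _); apply/subset_leq_card; apply/fintype.subsetP => j.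
    rewrite !inE => /asboolPn/not_andP[nY|/contrapT Zj]; apply/orP.
      by left; apply/asboolPn.
    by right; apply/asboolP.
  have X0i := cell_differ (Xl ord0) (Xl (widen_ord nB i)).
  apply: leq_add.
    apply: (atmost_card X0i YI) => j /asboolPn nY eq0; apply: nY; apply/eq0.
    exact/(Ym j).2.
  apply: (atmost_card X0i ZI) => j /asboolP XZ eq0.
  by apply: (proj1 (Zm j).2) => //; apply/eq0.
move=> spX x xl; apply: (atmost_sub (leqnn _)) (atmost_or spX (cell_differ (Xl ord0) xl)) => y.
case=> my xy; have [dy|/contrapT ndy] := pselect (differ (X ord0) x y); first by right.
by left; split=> //; rewrite ndy.
Qed.

(** This makes the predicted adjacency symmetric. The threshold in [small] is chosen so that two
    large cells contain a square of side [k + k + 1], too big for [grid_bound]. *)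
Lemma sparse_exclusive l m : ~ small l -> ~ small m -> sparse True l m -> ~ sparse False m l.
Proof.
move=> /not_atmost[X XI Xl] /not_atmost[Y YI Ym] spT spF.
suff : (k + k).+1 <= k + k by rewrite ltnn.
apply: (@grid_bound _ _ (fun i j => `[< E (X i) (Y j) >])) => i.
  by apply: (atmost_card (spT _ (Xl i)) YI) => j /asboolP Xj.
by apply: (atmost_card (spF _ (Ym i)) XI) => j /asboolPn Xj; split=> //; split=> // /Esym.
Qed.

Variables (N : nat) (t : 'I_N -> M).
Hypothesis tP : forall l x, small l -> cell l x -> exists i, x = t i.

Definition code : finType :=
  ({ffun 'I_K -> bool} * {ffun 'I_N -> bool} * {ffun 'I_N -> bool})%type.

(** Besides the cell, the code tells which listed vertex [x] is and how it meets the listed ones, so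
    that pairs with a listed vertex are predicted exactly. *)
Definition tau (x : M) : code :=
  (twins_code x, [ffun i => x == t i], [ffun i => `[< E x (t i) >]]).

Definition link (c c' : code) : bool :=
  if [pick i | c.1.2 i] is Some i then c'.2 i
  else if [pick i | c'.1.2 i] is Some i then c.2 i
  else if (cell_of c.1.1, cell_of c'.1.1) is (Some l, Some m)
       then `[< sparse False l m >] else false.

Variant link_spec (x y : M) : bool -> Prop :=
| LinkListed of (exists i, x = t i \/ y = t i) : link_spec x y `[< E x y >]
| LinkCells l m of ~ (exists i, x = t i \/ y = t i) & cell l x & cell m y & ~ small l & ~ small m :
    link_spec x y `[< sparse False l m >].

Lemma linkP x y : link_spec x y (link (tau x) (tau y)).
Proof.
rewrite /link /=; case: pickP => [i|nx].
  rewrite !ffunE => /eqP xi; have -> : `[< E y (t i) >] = `[< E x y >].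
    by apply/asbool_equiv_eq; rewrite -xi; split=> /Esym.
  by constructor; exists i; left.
case: pickP => [i|ny].
  rewrite !ffunE => /eqP yi; rewrite -yi.
  by constructor; exists i; right.
have [l xl] := cell_ex x; have [m ym] := cell_ex y.
rewrite (xl : cell_of _ = _) (ym : cell_of _ = _).
have large n z : [pred i | [ffun i => z == t i] i] =1 pred0 -> cell n z -> ~ small n.
  by move=> nz zn sn; have [i zi] := tP sn zn; have := nz i; rewrite /= ffunE zi eqxx.
constructor => //; [|exact: (large _ x)|exact: (large _ y)].
by case=> i [xi|yi]; [have := nx i|have := ny i]; rewrite /= ffunE ?xi ?yi eqxx.
Qed.

Lemma link_sym x y : link (tau x) (tau y) = link (tau y) (tau x).
Proof.
have imp x' y' : link (tau x') (tau y') -> link (tau y') (tau x').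
  case: linkP => [xy|l m nt xl ym nl nm] /asboolP sp; case: linkP => [yx|l' m' nt' yl' xm' _ _].
  - by apply/asboolP/Esym.
  - by case: nt'; case: xy => i [|] ->; exists i; [right|left].
  - by case: nt; case: yx => i [|] ->; exists i; [right|left].
  move: yl' xm'; rewrite /cell xl ym => -[<-] [<-]; apply/asboolP.
  by case: (large_sparse l nm) => // /(sparse_exclusive nm nl).
by apply/idP/idP; apply: imp.
Qed.

(** Errors occur only between large cells, where [x] meets at most [k] of them in each of the [K]
    cells. *)
Lemma link_atmost x : atmost (K * k) (fun y => ~ (E x y <-> link (tau x) (tau y))).
Proof.
have [l xl] := cell_ex x.
have: atmost (#|'I_K| * k) (fun y => exists m, [/\ cell m y, ~ small l, ~ small m & ~ (E x y <-> `[< sparse False l m >])]).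
  apply: atmost_ex => m.
  have [[nl' nm]|H] := pselect (~ small l /\ ~ small m); last first.
    by apply: (@atmost_cover _ _ [::]) => // y [_ ? ? _]; case: H.
  have [spF|nspF] := pselect (sparse False l m).
    apply: (atmost_sub (leqnn _)) (spF x xl) => y [my _ _ nE]; split=> //.
    by split=> // Exy; apply: nE; split=> // _; apply/asboolP.
  case: (large_sparse m nl') => // spT.
  apply: (atmost_sub (leqnn _)) (spT x xl) => y [my _ _ nE]; split=> //.
  by split=> // _; apply: contrapT => nExy; apply: nE; split=> // /asboolP.
rewrite card_ord; apply: (atmost_sub (leqnn _)) => y.
case: linkP => [_ []|l' m' _ xl' ym' nl' nm' nE]; first by split=> [/asboolP|/asboolP].
by exists m'; split=> //; move: xl'; rewrite /cell xl => -[->].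
Qed.

End NearCovered.

Lemma near_cover_listing (M : eqType) (E : M -> M -> Prop) (K : nat) (x0 : M)
    (k := 4 * (K + K) + (K + K)) : ~ far E K.+1 ->
  exists (a : 'I_K -> M) (t : 'I_(K * (k + k)) -> M),
    (forall x, exists i, twins E K x (a i)) /\
    (forall l x, small E a l -> cell E a l x -> exists i, x = t i).
Proof.
move=> /not_far_twins[s [sK sP]]; pose a (i : 'I_K) := nth x0 s i.
have : atmost (#|'I_K| * (k + k)) (fun x => exists l, small E a l /\ cell E a l x).
  apply: atmost_ex => l; have [sl|nl] := pselect (small E a l).
    by apply: (atmost_sub (leqnn _)) sl => x [].
  by apply: (@atmost_cover _ _ [::]) => // x [].
rewrite card_ord => /atmost_list[u [_ uk uP]].
exists a, (fun i => nth x0 u i); split.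
  move=> x; have [b bs xb] := sP x.
  have bK : index b s < K by apply: leq_trans sK; rewrite index_mem.
  by exists (Ordinal bK); rewrite /a /= nth_index.
move=> l x sl xl; have xu : x \in u by apply/uP; exists l.
have xk : index x u < K * (k + k) by apply: leq_trans uk; rewrite index_mem.
by exists (Ordinal xk); rewrite nth_index.
Qed.

(** Induction on the types. For disjoint [A] and [B], the squares of their union, of [A] and of [B]
    add up modulo 2 to the pairs across. With [A] the new type and [B] the treated types linked to
    it, this settles the pairs across, and a fourth set the pairs inside [A]. *)
Lemma parity_types (G : sgraph) (T : finType) (tau : G -> T) (g : T -> T -> bool) :
    (forall x y, g (tau x) (tau y) = g (tau y) (tau x)) ->
  exists2 As : seq (pred G), size As = 4 * #|T| &
    forall x y, parity As x y = g (tau x) (tau y).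
Proof.
move=> gsym; suff [As Ass AsP] : exists2 As : seq (pred G), size As = 4 * size (enum T) &
    forall x y, parity As x y = [&& tau x \in enum T, tau y \in enum T & g (tau x) (tau y)].
  by exists As => [|x y]; rewrite ?cardE // AsP !mem_enum.
elim: (enum T) (enum_uniq T) => [_|t ts IH /= /andP[tts /IH[As Ass AsP]]].
  by exists [::] => // x y; rewrite /parity big_nil.
pose A : pred G := fun x => tau x == t.
pose B : pred G := fun x => (tau x \in ts) && g t (tau x).
exists [:: (fun x => A x || B x), A, B, (fun x => A x && g t t) & As].
  by rewrite /= Ass mulnS.
move=> x y; rewrite /parity !big_cons -/(parity As x y) AsP !inE /A /B /=.
have := gsym x y; have [xt|_] := eqVneq (tau x) t; have [yt|_] := eqVneq (tau y) t.
- by rewrite xt yt (negPf tts); case: (g t t).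
- by rewrite xt (negPf tts) => _; case: (tau y \in ts); case: (g t t); case: (g t (tau y)).
- by rewrite yt (negPf tts) => ->; case: (tau x \in ts); case: (g t t); case: (g t (tau x)).
move=> _; case: (tau x \in ts); case: (tau y \in ts); case: (g t (tau x));
  by case: (g t (tau y)); case: (g (tau x) (tau y)); case: (g t t).
Qed.

Lemma xflipK (G : sgraph) (As : seq (pred G)) : graph_iso (@xflip (xflip As) As) G.
Proof.
exists id; first by exists id.
by move=> x y; rewrite /= /xflip_adj /= /xflip_adj -addbA addbb addbF.
Qed.

Lemma iso_xflip (G H : sgraph) (f : G -> H) (g : H -> G) (As : seq (pred G)) :
    cancel f g -> cancel g f -> (forall x y, adj (f x) (f y) = adj x y) ->
  graph_iso (xflip As) (xflip [seq A \o g | A <- As] : sgraph).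
Proof.
move=> fK gK fadj; exists f; first by exists g.
move=> x y; rewrite /= /xflip_adj fadj (inj_eq (can_inj fK)) /parity big_map.
by congr (_ (+) (_ && _)); apply: eq_bigr => A _; rewrite /= !fK.
Qed.

Lemma degree_iso (G H : sgraph) (f : G -> H) (g : H -> G) (x : H) :
    cancel f g -> cancel g f -> (forall x y, adj (f x) (f y) = adj x y) ->
  degree x = degree (g x).
Proof.
move=> fK gK fadj; rewrite /degree -(fintype.card_image (can_inj fK)).
apply: eq_card => y; rewrite !inE -{2}[y]gK (fintype.mem_image (can_inj fK)) inE.
by rewrite -fadj !gK.
Qed.

Lemma degree_induced (G : sgraph) (A : pred G) (x : induced A) :
  degree x <= degree (val x).
Proof.
have valI : injective (fun u : induced A => val u) by apply: val_inj.
rewrite /degree -(fintype.card_image valI); apply: subset_leq_card.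
by apply/fintype.subsetP => y /fintype.imageP[u xu ->].
Qed.

Lemma near_covered_perturbation C : graph_class C -> hereditary C -> near_covered C ->
  exists D : graphs, [/\ graph_class D, hereditary D, bounded_degree D,
    transduction_equivalent C D & perturbation_of C D].
Proof.
move=> [Ciso C0] Cher [[|K] CK].
  (* [far] at 0 holds vacuously and [C] contains a graph, so the bound is positive. *)
  by case: (CK _ C0); exists (fun i => of_I0 _ i); case.
pose k := 4 * (K + K) + (K + K).
pose p := 4 * #|code K (K * (k + k))|.
(* Flipping twice along the same sets is the identity, so [D] can be defined by flipping back into
   [C]. Fixing the number [p] of sets keeps [D] hereditary, because sets restrict to induced
   subgraphs. *)
pose D (H : sgraph) := (forall x : H, degree x <= K * k) /\
  exists2 As : seq (pred H), size As = p & C (xflip As).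
have DC H : D H -> exists (G : sgraph) (As : seq (pred G)),
    [/\ size As = p, graph_iso (xflip As) H & C G].
  by move=> [_ [As Asp CG]]; exists (xflip As), As; split=> //; apply: xflipK.
have CD G : C G -> exists (H : sgraph) (As : seq (pred H)),
    [/\ size As = p, graph_iso (xflip As) G & D H].
  move=> CG; suff [As Asp Asd] : exists2 As : seq (pred G), size As = p &
      forall x : xflip As, degree x <= K * k.
    exists (xflip As), As; split=> //; first exact: xflipK.
    split=> //; exists As => //; apply: Ciso CG.
    by apply: graph_iso_sym; apply: xflipK.
  have [x0|nG] := pickP (fun x : G => true); last first.
    by exists (nseq p (xpred0 : pred G)) => [|x]; [rewrite size_nseq|have := nG x].
  have Esym (x y : G) : adj x y -> adj y x by rewrite adj_sym.
  have [a [t [aP tP]]] := near_cover_listing x0 (CK G CG).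
  have [As Asp AsP] := parity_types (link_sym Esym aP tP).
  exists As => // x; rewrite /degree cardE.
  have sp := @link_atmost _ _ _ Esym a aP _ t tP x.
  apply: sp => [|y]; first exact: enum_uniq.
  rewrite mem_enum inE /= /xflip_adj AsP.
  have [->|_] := eqVneq x y; first by rewrite adj_irrefl.
  by case: (@adj G x y); case: (link _ _ _) => // _ [H1 H2]; [have := H1 isT|have := H2 isT].
exists D; split.
- split.
    move=> G H [f [g fK gK] fadj] [Gd [As Asp CG]]; split.
      by move=> x; rewrite (degree_iso x fK gK fadj).
    exists [seq A \o g | A <- As]; first by rewrite size_map.
    by apply: Ciso CG; apply: iso_xflip.
  split; first by case.
  exists (nseq p (xpred0 : pred empty_graph)); first by rewrite size_nseq.
  apply: Ciso C0; exists id; first by exists id.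
  by case.
- move=> H A [Hd [As Asp CG]]; split=> [x|].
    exact: leq_trans (degree_induced x) (Hd _).
  exists [seq (fun u => B (val u)) | B <- As]; first by rewrite size_map.
  have CI := Cher (xflip As) A CG.
  apply: Ciso CI; exists id; first by exists id.
  move=> x y; rewrite /= /xflip_adj /induced_adj /= /xflip_adj val_eqE.
  by rewrite /parity big_map.
- by exists (K * k) => H [].
- split; apply: noncopying_transduction; apply: (@xflip_transduction p) => //.
- exists p => G /CD[H [As [<- HG DH]]]; exists H => //.
  exact: perturb_iso (perturb_xflip As) HG.
Qed.

(** * Inflated patterns and star forests *)

(** The center is chosen at the root of each component, which makes it constant on components even
    where a star has several possible centers. *)
Lemma star_forest_center (G : sgraph) : star_forests G ->
  exists cen : G -> G, forall x y : G,
    adj x y = [&& x != y, cen x == cen y & (x == cen x) || (y == cen x)].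
Proof.
move=> [_ Gstar]; have csym : connect_sym (@adj G) by apply: sym_connect_sym; apply: adj_sym.
have /choice[ctr ctrP] : forall r : G, exists c, connect (@adj G) r c /\
    forall x y, connect (@adj G) r x -> connect (@adj G) r y ->
    adj x y = (x != y) && ((x == c) || (y == c)).
  move=> r; have [[c rc] cP] := Gstar r; exists c; split=> // x y rx ry.
  by have := cP (exist _ x rx) (exist _ y ry); rewrite -!val_eqE.
pose rt := fingraph.root (@adj G).
have rtP x : connect (@adj G) (rt x) x by rewrite csym connect_root.
exists (fun x => ctr (rt x)) => x y.
have [xy|xy] := boolP (connect (@adj G) x y).
  have -> : rt y = rt x by apply/eqP; rewrite eq_sym root_connect.
  rewrite eqxx /=; apply: (proj2 (ctrP (rt x))) => //.
  exact: connect_trans (rtP x) xy.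
have -> : adj x y = false by apply: contraNF xy => /connect1.
apply/esym/negbTE; rewrite !negb_and; apply/orP; right; apply/orP; left.
apply: contraNneq xy => cc.
have xc := connect_trans _ (proj1 (ctrP (rt x))); rewrite cc in xc.
apply: connect_trans (xc _ _) _; first by rewrite connect_root.
rewrite csym; apply: connect_trans (proj1 (ctrP (rt y))); exact: connect_root.
Qed.

(** [r] need not be symmetric: only pairs in list order are compared, which suits ordered
    patterns. *)
Lemma ramsey_pairwise (A : eqType) (r : rel A) a b (s : seq A) : 2 ^ (a + b) <= size s ->
  (exists s', [/\ subseq s' s, size s' = a & pairwise r s']) \/
  (exists s', [/\ subseq s' s, size s' = b & pairwise (fun x y => ~~ r x y) s']).
Proof.
elim: {a b}(a + b) {-2}a {-2}b (leqnn (a + b)) s => [|n IH] a b abn s.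
  by move: abn; rewrite leqn0 addn_eq0 => /andP[/eqP -> _] _; left; exists [::]; rewrite sub0seq.
case: a b abn => [|a] [|b] abn; try by [left; exists [::]; rewrite sub0seq|right; exists [::]; rewrite sub0seq].
case: s => [|x s]; first by rewrite leqn0 expn_eq0.
rewrite [size _]/= => sz.
have : 2 ^ (a + b.+1) <= count (r x) s \/ 2 ^ (a + b.+1) <= count (predC (r x)) s.
  apply/orP; move: sz; rewrite addSn expnS -(count_predC (r x)); lia.
rewrite addSn ltnS in abn.
case; rewrite -size_filter.
  move=> /(IH _ _ abn)[[s' [ss' ss'a rs']]|[s' [ss' ss'b rs']]]; [left|right].
    exists (x :: s'); split=> /=; first by rewrite eqxx (subseq_trans ss') ?filter_subseq.
      by rewrite ss'a.
    rewrite rs' andbT; apply/allP => y /(mem_subseq ss').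
    by rewrite mem_filter => /andP[].
  exists s'; split=> //; apply: (subseq_trans ss').
  exact: (subseq_trans (filter_subseq _ _) (subseq_cons _ _)).
rewrite -addSnnS; rewrite -addSnnS in abn; move=> /(IH _ _ abn)[[s' [ss' ss'a rs']]|[s' [ss' ss'b rs']]]; [left|right].
  exists s'; split=> //; apply: (subseq_trans ss').
  exact: (subseq_trans (filter_subseq _ _) (subseq_cons _ _)).
exists (x :: s'); split=> /=; first by rewrite eqxx (subseq_trans ss') ?filter_subseq.
  by rewrite ss'b.
rewrite rs' andbT; apply/allP => y /(mem_subseq ss').
by rewrite mem_filter => /andP[].
Qed.

(** Take a test separating two elements, keep a side with at least half of them, and record the test
    with an element of the other side: all later elements answer it oppositely. *)
Lemma splitting_sequence (A T : eqType) (R : A -> T -> bool) (F : T -> Prop) :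
    (forall x y, x != y -> exists2 t, F t & R x t != R y t) ->
  forall l (X : seq A), uniq X -> 2 ^ l <= size X ->
  exists s : seq (A * T * bool), [/\ size s = l,
    forall p, p \in s -> [/\ p.1.1 \in X, F p.1.2 & R p.1.1 p.1.2 = ~~ p.2]
    & pairwise (fun p q => R q.1.1 p.1.2 == p.2) s].
Proof.
move=> sep; elim=> [|l IH] X uX lX; first by exists [::].
case: X uX lX => [|x [|y X']]; first by rewrite leqn0 expn_eq0.
  by move=> _; rewrite expnS /= leqNgt -{1}(muln1 2) leq_pmul2l // expn_gt0.
set X := [:: x, y & X'] => uX lX.
have xy : x != y by move: uX; rewrite /= inE => /andP[/norP[]].
have [t Ft xyt] := sep x y xy.
have [e Xe] : exists e, 2 ^ l <= count (fun z => R z t == e) X.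
  have : 2 ^ l <= count (fun z => R z t) X \/ 2 ^ l <= count (predC (fun z => R z t)) X.
    by apply/orP; move: lX; rewrite expnS -(count_predC (fun z => R z t)); lia.
  case=> H; [exists true|exists false]; apply: leq_trans H _; apply: sub_count => z /=.
    by case: (R z t).
  by case: (R z t).
have [z zX zt] : exists2 z, z \in X & R z t = ~~ e.
  have [xe|xe] := boolP (R x t == e); [exists y|exists x]; rewrite ?inE ?eqxx ?orbT //.
    by move: xyt; rewrite (eqP xe); case: (R y t); case: (e).
  by move: xe; case: (R x t); case: (e).
have [|s [sl sF sp]] := IH [seq z <- X | R z t == e] (filter_uniq _ uX).
  by rewrite size_filter.
exists ((z, t, e) :: s); split=> /=.
- by rewrite sl.
- move=> p; rewrite inE => /predU1P[->//|/sF[+ ? ?]].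
  by rewrite mem_filter => /andP[].
rewrite sp andbT; apply/allP => q /sF[+ _ _].
by rewrite mem_filter => /andP[].
Qed.

(** The answers of later elements to earlier tests are settled up to the sign [e], which pigeonhole
    fixes at the cost of the factor 2; Ramsey fixes those of earlier elements to later tests. *)
Lemma half_graph (A T : eqType) (R : A -> T -> bool) (F : T -> Prop) (m : nat) (X : seq A) :
    (forall x y, x != y -> exists2 t, F t & R x t != R y t) ->
    uniq X -> 2 ^ (2 * 2 ^ (m + m)) <= size X ->
  exists (e d : bool) (x : 'I_m -> A) (t : 'I_m -> T), (forall i, F (t i)) /\
    forall i j, R (x j) (t i) = if j == i then ~~ e else if j < i then d else e.
Proof.
move=> sep uX sX; have [s [sl sF sp]] := splitting_sequence sep uX sX.
have [e se] : exists e, 2 ^ (m + m) <= count (fun p => p.2 == e) s.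
  have : 2 ^ (m + m) <= count (fun p => p.2) s \/ 2 ^ (m + m) <= count (predC (fun p => p.2)) s.
    by apply/orP; move: sl; rewrite -(count_predC (fun p => p.2)); lia.
  case=> H; [exists true|exists false]; apply: leq_trans H _; apply: sub_count => p /=.
    by case: (p.2).
  by case: (p.2).
rewrite -size_filter in se.
have [d [s' [s's s'm s'd]]] : exists d s', [/\ subseq s' [seq p <- s | p.2 == e], size s' = m
    & pairwise (fun p q => R p.1.1 q.1.2 == d) s'].
  have [[s' [? ? H]]|[s' [? ? H]]] := ramsey_pairwise (fun p q => R p.1.1 q.1.2) se;
    [exists true|exists false]; exists s'; split=> //; apply: sub_pairwise H => p q /=.
    by move=> ->.
  by case: (R _ _).
have s'e p : p \in s' -> [/\ F p.1.2, R p.1.1 p.1.2 = ~~ e & p.2 = e].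
  move=> /(mem_subseq s's); rewrite mem_filter => /andP[/eqP pe /sF[_ ? Rp]].
  by split=> //; rewrite Rp pe.
have sp' := subseq_pairwise (subseq_trans s's (filter_subseq _ _)) sp.
case: s' {s's} s'm s'd s'e sp' => [m0|p0 s'] .
  by subst m; exists e, d, (of_I0 _), (of_I0 _); split; case.
set s1 := p0 :: s' => s1m s1d s1e s1p.
have nth1 (i : 'I_m) : nth p0 s1 i \in s1 by rewrite mem_nth // s1m.
exists e, d, (fun i => (nth p0 s1 i).1.1), (fun i => (nth p0 s1 i).1.2).
split=> [i|i j]; first by case: (s1e _ (nth1 i)).
have sz (l : 'I_m) : (l : nat) \in gtn (size s1) by rewrite inE s1m.
have [ij|ij|/val_inj ->] := ltngtP j i.
- have -> : (j == i) = false by apply/negbTE; rewrite neq_ltn ij.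
  exact: (eqP (pairwiseP p0 s1d _ _ (sz j) (sz i) ij)).
- have -> : (j == i) = false by apply/negbTE; rewrite neq_ltn ij orbT.
  rewrite (eqP (pairwiseP p0 s1p _ _ (sz i) (sz j) ij)).
  by case: (s1e _ (nth1 i)).
by rewrite eqxx; case: (s1e _ (nth1 i)).
Qed.

(* A half-graph, matching or co-matching between the x j and the classes
   {y i l | l}, each class consisting of m twins with respect to the x j. *)
Definition inflated (G : sgraph) (m : nat) : Prop :=
  exists (e d : bool) (x : 'I_m -> G) (y : 'I_m -> 'I_m -> G),
    [/\ injective x, forall i l j k, y i l = y j k -> i = j /\ l = k,
      forall i j l, x i <> y j l &
      forall i j l, adj (x j) (y i l) = e (+) (if j == i then true else (j < i) && d)].

(** The tests are the traces on [n] chosen vertices that at least [m] other vertices have. Two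
    chosen vertices differ in more than [2 ^ n * m + n] places: more than the chosen vertices and
    the vertices of rarer traces together, so a frequent trace separates them. *)
Lemma far_inflated m : exists K, forall G : sgraph, far (fun x y : G => adj x y) K -> inflated G m.
Proof.
pose n := (2 ^ (2 * 2 ^ (m + m))).
have n0 : 0 < n by rewrite expn_gt0.
exists (#|{set 'I_n}| * m + n).+1 => G [x0 x0P].
have nK : n <= (#|{set 'I_n}| * m + n).+1 by rewrite leqW // leq_addl.
pose x i := x0 (widen_ord nK i).
have xP i j : i != j -> ~ atmost (#|{set 'I_n}| * m + n)
    (fun z => ~ (adj (x i) z <-> adj (x j) z)).
  move=> ij; have [b bI bP] := x0P (widen_ord nK i) (widen_ord nK j) ij.
  exact: (atmost_inj bI bP).
have xI : injective x.
  move=> i j xij; apply/eqP/contraT => /xP []; rewrite xij.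
  by apply: (@atmost_cover _ _ [::]) => // z [].
pose tr z := [set i | adj (x i) z].
pose cls t := [seq z <- enum G | (tr z == t) && (z \notin codom x)].
have sep i j : i != j -> exists2 t : {set 'I_n}, m <= size (cls t) & (i \in t) != (j \in t).
  move=> ij; apply: contrapT => /forall2NP H; apply: (xP i j ij).
  have few : atmost (#|{set 'I_n}| * m) (fun z => exists t : {set 'I_n},
      (i \in t) != (j \in t) /\ z \in cls t).
    apply: atmost_ex => t; have [ijt|ijt] := boolP ((i \in t) == (j \in t)).
      by apply: (@atmost_cover _ _ [::]) => // z [].
    apply: (@atmost_cover _ _ (cls t)) => [|z []//].
    by case: (H t) => // /negP; rewrite -ltnNge => /ltnW.
  have fewx : atmost n (fun z => z \in codom x).
    by apply: (@atmost_cover _ _ (codom x)) => //; rewrite size_codom card_ord.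
  apply: (atmost_sub (leqnn _)) (atmost_or few fewx) => z nz.
  have [zx|zx] := boolP (z \in codom x); [by right|left]; exists (tr z); split.
    rewrite !inE; apply/eqP => H'; apply: nz; rewrite H'; exact: iff_refl.
  by rewrite mem_filter eqxx zx mem_enum.
have szX : n <= size (enum 'I_n) by rewrite size_enum_ord.
have [e [d [a [t [tm tP]]]]] := half_graph (R := fun i (t : {set 'I_n}) => i \in t)
  sep (enum_uniq _) szX.
pose y i l := nth (x (Ordinal n0)) (cls (t i)) (l : 'I_m).
have yc i l : y i l \in cls (t i) by rewrite mem_nth // (leq_trans (ltn_ord l)).
have ytr i l : tr (y i l) = t i.
  by have := yc i l; rewrite mem_filter => /andP[/andP[/eqP]].
have ynx i l : y i l \notin codom x.
  by have := yc i l; rewrite mem_filter => /andP[/andP[]].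
have adjE i j l : adj (x (a j)) (y i l) = if j == i then ~~ e else if j < i then d else e.
  by rewrite -tP -(ytr i l) inE.
have tI i j : t i = t j -> i = j.
  wlog ij : i j / i < j.
    move=> W tij; have [/W ->//|/W ji|/val_inj//] := ltngtP i j.
    by apply/esym/ji.
  move=> tij; have := tP i j; have := tP j j; rewrite tij eqxx => ->.
  by rewrite -[j == i]negbK neq_ltn ij orbT /= ltnNge (ltnW ij) /=; case: (e).
have aI : injective a.
  move=> i j; wlog ij : i j / i < j.
    move=> W aij; have [/W ->//|/W ji|/val_inj//] := ltngtP i j.
    by apply/esym/ji.
  move=> aij; have := tP i j; have := tP i i; rewrite aij eqxx => ->.
  by rewrite -[j == i]negbK neq_ltn ij orbT /= ltnNge (ltnW ij) /=; case: (e).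
(* [half_graph] gives [d] as an absolute answer, [inflated] wants it relative to [e]. *)
exists e, (e (+) d), (fun i => x (a i)), y; split.
- exact: inj_comp.
- move=> i l j k yij; have ij : i = j by apply: tI; rewrite -(ytr i l) yij.
  split=> //; subst j; apply/val_inj/eqP.
  rewrite -(nth_uniq (x (Ordinal n0)) (leq_trans (ltn_ord l) (tm i))
    (leq_trans (ltn_ord k) (tm i)) (filter_uniq _ (enum_uniq G))).
  by apply/eqP; exact: yij.
- by move=> i j l xy; have := ynx j l; rewrite -xy codom_f.
move=> i j l; rewrite adjE; case: (j == i); first by case: (e).
by case: (j < i); case: (e); case: (d).
Qed.

Section StarForm.
Local Notation color := nat.

(* Color 3 is carried by all vertices or by none, to complement adjacency. *)
Definition flagged V (x y : V) : form color V := Neg (Iff (Adj _ x y) (Col 3 x)).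

Definition below : form color (option 'I_2) :=
  All (Imp (And (Col 2 None) (flagged (Some (Some ord0)) None))
    (flagged (Some None) None)).

Definition minimal : form color 'I_2 :=
  All (Imp (And (Col 1 None) (flagged None (Some ord_max))) below).

(* Among the x' (color 1) joined to y (color 2), x has the smallest
   neighbourhood: in a half-graph, this singles out the x with the index of y. *)
Definition star_form : form color 'I_2 :=
  And (Col 1 ord0) (And (Col 2 ord_max) (And (flagged ord0 ord_max) minimal)).

Variable M : structure color.
Let J (x y : M) := ~ (sadj x y <-> scol 3 x).

Lemma sat_flagged V (x y : V) (e : V -> M) : sat (flagged x y) e <-> J (e x) (e y).
Proof.
have E := sat_Iff (Adj color x y) (Col 3 x) e.
by split=> H1 H2; apply: H1; [apply: (proj2 E)|apply: (proj1 E)].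
Qed.

Lemma sat_below (e : option 'I_2 -> M) :
  sat below e <-> forall z, scol 2 z -> J (e (Some ord0)) z -> J (e None) z.
Proof.
rewrite sat_All; split=> H z.
  move=> z2 Jz; apply: (proj1 (sat_flagged (Some None) None (oapp e z))).
  by apply: (proj1 (sat_Imp _ _ _) (H z)); split=> //; apply: (proj2 (sat_flagged _ _ _)).
apply: (proj2 (sat_Imp _ _ _)) => -[z2 Jz]; apply: (proj2 (sat_flagged _ _ _)).
exact: H z2 (proj1 (sat_flagged _ _ _) Jz).
Qed.

Lemma sat_minimal (e : 'I_2 -> M) : sat minimal e <-> forall x', scol 1 x' ->
  J x' (e ord_max) -> forall z, scol 2 z -> J (e ord0) z -> J x' z.
Proof.
rewrite sat_All; split=> H x'.
  move=> x1 Jx; apply: (proj1 (sat_below (oapp e x'))).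
  by apply: (proj1 (sat_Imp _ _ _) (H x')); split=> //; apply: (proj2 (sat_flagged _ _ _)).
apply: (proj2 (sat_Imp _ _ _)) => -[x1 Jx]; apply: (proj2 (sat_below _)).
exact: H x1 (proj1 (sat_flagged _ _ _) Jx).
Qed.

Lemma sat2_star_form (x y : M) :
  sat2 star_form x y <->
  [/\ scol 1 x, scol 2 y, J x y & forall x', scol 1 x' -> J x' y ->
    forall z, scol 2 z -> J x z -> J x' z].
Proof.
have mE := sat_minimal (tnth [tuple x; y]).
have fE := sat_flagged ord0 ord_max (tnth [tuple x; y]).
split=> [[? [? [f m]]]|[? ? f m]].
  by split=> //; [apply: (proj1 fE)|apply: (proj1 mE)].
by split=> //; split=> //; split; [apply: (proj2 fE)|apply: (proj2 mE)].
Qed.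

End StarForm.

Lemma not_near_covered_star_forests C : ~ near_covered C ->
  noncopying_transduction_of star_forests C.
Proof.
move=> nC; apply: (@interpretable_transduction nat 0 star_form) => H.
move=> /star_forest_center[cen cenP].
have [K KP] := far_inflated #|H|.
have [G CG /KP[e [d [x [y [xI yI xy adjE]]]]]] : exists2 G, C G &
    far (fun x y : G => adj x y) K.
  apply: contrapT => nG; apply: nC; exists K => G CG fG.
  by apply: nG; exists G.
exists G => //.
pose rk (h : H) : 'I_#|H| := enum_rank h.
(* A leaf goes to the class of its center, and its own rank gives it a separate member of that
   class. *)
pose f h := if h == cen h then x (rk h) else y (rk (cen h)) (rk h).
(* Colors 1 and 2 mark the entire pattern rather than the image of [H], because minimality compares
   with all of it. *)
pose c : coloring nat G := fun u z => match u with
  | 0 => z \in codom f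
  | 1 => z \in codom x
  | 2 => [exists i, z \in codom (y i)]
  | _ => e end.
exists c, f; split.
- move=> h h'; rewrite /f; case: eqP => hc; case: eqP => hc'.
  + by move=> /xI/enum_rank_inj.
  + by move=> /xy.
  + by move=> /esym/xy.
  + by move=> /yI[_ /enum_rank_inj].
- by move=> z; split=> [/codomP[h ->]|[h <-]]; [exists h|apply: codom_f].
pose P (j i : 'I_#|H|) := if j == i then true else (j < i) && d.
have JE i j l : ~ (adj (x j) (y i l) <-> e) <-> P j i.
  rewrite adjE -/(P j i); case: (e); case: (P j i) => /=; clear; intuition congruence.
(* If [j < i], then [x i] is joined to [y i l] too but not to [y j l], which refutes the minimality
   of [x j]. *)
have phiE i j l : @sat2 nat (colored_graph c) star_form (x j) (y i l) <-> j = i.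
  rewrite sat2_star_form /=; split=> [[_ _ /JE Pji mn]|->].
    have Pkk k : P k k by rewrite /P eqxx.
    have yj : [exists k, y j l \in codom (y k)] by apply/existsP; exists j; apply: codom_f.
    have /JE := mn (x i) (codom_f _ _) (proj2 (JE i i l) (Pkk i)) (y j l) yj
      (proj2 (JE j j l) (Pkk j)).
    move: Pji; rewrite /P eq_sym; case: eqP => [->//|_] /andP[ji _].
    by rewrite [i < j]ltnNge (ltnW ji).
  split; first exact: codom_f.
  - by apply/existsP; exists i; apply: codom_f.
  - by apply/JE; rewrite /P eqxx.
  move=> _ /codomP[j' ->] /JE Pj'i _ /existsP[i' /codomP[l' ->]] /JE Pii'; apply/JE.
  move: Pj'i Pii'; rewrite /P; have [->//|_] := eqVneq j' i => /andP[j'i ->].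
  have [<-|_] := eqVneq i i'; first by rewrite j'i; case: eqP.
  by move=> /andP[ii' _]; rewrite (ltn_trans j'i ii'); case: eqP.
have cX u v : @sat2 nat (colored_graph c) star_form (f u) (f v) <->
    [/\ u = cen u, v <> cen v & u = cen v].
  rewrite /f; case: eqP => uc; case: eqP => vc.
  - split=> [/sat2_star_form[_ /existsP[i /codomP[l /xy]]]//|[]//].
  - rewrite phiE; split=> [/enum_rank_inj|[_ _ ->]//]; by [].
  - by split=> [/sat2_star_form[/codomP[i /esym/xy]]|[]].
  - by split=> [/sat2_star_form[/codomP[i /esym/xy]]|[]].
move=> u v; rewrite cenP; split.
  move=> /and3P[/eqP uv /eqP cc /orP[/eqP uc|/eqP vc]]; split=> //.
    by left; apply/cX; split=> //; rewrite -?cc // -uc => /esym.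
  by right; apply/cX; split=> //; rewrite -?cc // -vc.
move=> [/eqP uv [/cX[uc vc ucv]|/cX[vc uc vcu]]]; rewrite uv /=.
  by rewrite -ucv -uc !eqxx.
by rewrite -vcu -vc !eqxx orbT.
Qed.

(** * Definability with parameters *)

(** [R] is the finite disjunction of the truth patterns of the [Q i] realized in [R], spelled with
    negations and conjunctions. *)
Lemma boolean_closure (X : Type) (B : (X -> Prop) -> Prop) (I : finType)
    (Q : I -> X -> Prop) (R : X -> Prop) :
    B (fun=> True) -> (forall P, B P -> B (fun x => ~ P x)) ->
    (forall P P', B P -> B P' -> B (fun x => P x /\ P' x)) ->
    (forall i, B (Q i)) -> (forall x y, (forall i, Q i x <-> Q i y) -> R x -> R y) ->
  B R.
Proof.
move=> BT BN BA BQ RQ.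
have ext P P' : (forall x, P x <-> P' x) -> B P -> B P'.
  by move=> PP'; have -> : P = P' by apply/funext => x; apply/propext.
have Ball (J : finType) (P : J -> X -> Prop) :
    (forall j, B (P j)) -> B (fun x => forall j, P j x).
  move=> BP; apply: (ext (fun x => forall j, j \in enum J -> P j x)).
    by move=> x; split=> H j; [apply: H; rewrite mem_enum|].
  elim: (enum J) => [|j s IH]; first by apply: ext BT.
  apply: ext (BA _ _ (BP j) IH) => x; split=> [[Pj H] j'|H].
    by rewrite inE => /predU1P[->|/H].
  by split=> [|j' js]; apply: H; rewrite inE ?eqxx ?js ?orbT.
pose good (p : {set I}) := exists2 x, R x & forall i, Q i x <-> i \in p.
apply: (ext (fun x => ~ forall p : {set I}, ~ (good p /\ forall i, Q i x <-> i \in p))).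
  move=> x; rewrite -existsNE; split=> [[p /contrapT[[y Ry yp] xp]]|Rx].
    by apply: RQ Ry => i; rewrite yp xp.
  exists [set i | `[< Q i x >]]; apply; split.
    by exists x => // i; rewrite inE asboolE.
  by move=> i; rewrite inE asboolE.
apply: (BN); apply: (Ball) => p; apply: (BN); apply: (BA).
  have [gp|ngp] := pselect (good p); first by apply: ext BT.
  by apply: ext (BN _ BT) => x; split=> // nT; case: nT.
apply: (Ball) => i; case: (boolP (i \in p)) => ip.
  by apply: ext (BQ i) => x; split=> [Qi|[_]]; [split|apply].
by apply: ext (BN _ (BQ i)) => x; split=> [nQ|[H _] Qx]; [split|have := H Qx].
Qed.

Definition sum_env (M V : Type) (e : V -> M) (v : V + M) : M :=
  match v with inl v => e v | inr m => m end.

Definition definable U (N : structure U) V (R : (V -> N) -> Prop) : Prop :=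
  exists psi : form U (V + N), forall e, R e <-> sat psi (sum_env e).

Definition distinct_form U V (v0 : V) c (b : 'I_c -> V) : form U V :=
  Allf v0 (fun p : 'I_c * 'I_c => if p.1 == p.2 then Eq U v0 v0 else Neg (Eq U (b p.1) (b p.2))).

Lemma sat_distinct_form U (M : structure U) V (v0 : V) c (b : 'I_c -> V) (e : V -> M) :
  sat (distinct_form U v0 b) e <-> injective (e \o b).
Proof.
rewrite sat_Allf; split=> [H i j eij|bI [i j] /=].
  by apply/eqP; have := H (i, j) => /=; case: eqP.
by case: eqP => //= ij eij; apply: ij; apply: bI.
Qed.

Section Definable.
Variables (U : Type) (N : structure U).

Lemma definable_neg V (R : (V -> N) -> Prop) :
  definable R -> definable (fun e => ~ R e).
Proof. by move=> [psi H]; exists (Neg psi) => e; rewrite H. Qed.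

Lemma definable_and V (R R' : (V -> N) -> Prop) :
  definable R -> definable R' -> definable (fun e => R e /\ R' e).
Proof. by move=> [psi H] [psi' H']; exists (And psi psi') => e; rewrite H H'. Qed.

Lemma definable_true V : @definable U N V (fun=> True).
Proof.
exists (Neg (Ex (Neg (Eq U None None)))) => e.
by split=> // _ [m]; apply.
Qed.

Lemma definable_exn V c (I : finType) (P : 'I_c -> I -> Prop)
    (R : I -> (option V -> N) -> Prop) : 0 < c -> (forall i, definable (R i)) ->
  definable (fun e => exists2 b : 'I_c -> N, injective b &
    forall k i, P k i -> R i (oapp e (b k))).
Proof.
move=> c0 /choice[psi psiP].
pose v0 : 'I_c + (V + N) := inl (Ordinal c0).
pose g k (v : option V + N) : 'I_c + (V + N) := match v with
  | inl None => inl k | inl (Some v) => inr (inl v) | inr m => inr (inr m) end.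
exists (Exn (And (distinct_form U v0 inl)
  (Allf v0 (fun p : 'I_c * I =>
    if `[< P p.1 p.2 >] then form_map (g p.1) (psi p.2) else Eq U v0 v0)))) => e.
have gE k (b : 'I_c -> N) : envn b (sum_env e) \o g k = sum_env (oapp e (b k)).
  by apply/funext => -[[v|]|m].
rewrite sat_Exn; split=> [[b bI bP]|[b [bI bP]]]; exists b.
- split; first by apply/sat_distinct_form.
  apply/sat_Allf => -[k i] /=; case: asboolP => // Pki.
  by rewrite sat_map gE -psiP; apply: bP.
- exact: (proj1 (sat_distinct_form _ _ _) bI).
move=> k i Pki; have := proj1 (sat_Allf _ _ _) bP (k, i) => /=.
by case: asboolP => // _; rewrite sat_map gE -psiP.
Qed.

Lemma closed_definable : closed_definability (@definable U N).
Proof.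
split.
- by move=> V; have := definable_neg (definable_true V); rewrite not_True.
- by move=> V x y; exists (Eq U (inl x) (inl y)).
- by move=> V u x; exists (Col u (inl x)).
- move=> V W f R [psi H]; exists (form_map (fun v => match v with
    inl w => inl (f w) | inr m => inr m end) psi) => e.
  by rewrite sat_map H (_ : _ \o _ = sum_env (e \o f)) //; apply/funext; case.
- move=> V R a [psi H]; exists (form_map (fun v => match v with
    inl (Some w) => inl w | inl None => inr a | inr m => inr m end) psi) => e.
  by rewrite sat_map H (_ : _ \o _ = sum_env (oapp e a)) //; apply/funext => -[[]|].
- move=> V R [psi H]; pose g (v : option V + N) : option (V + N) := match v with
    inl (Some w) => Some (inl w) | inl None => None | inr m => Some (inr m) end.
  exists (Ex (form_map g psi)) => e.
  have E y : sat (form_map g psi) (oapp (sum_env e) y) <-> R (oapp e y).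
    by rewrite sat_map H (_ : _ \o _ = sum_env (oapp e y)) //; apply/funext => -[[]|].
  by split=> -[y Ry]; exists y; apply/(E y).
exact: definable_exn.
Qed.

Lemma definable_det (I : finType) V (Q : I -> (V -> N) -> Prop) (R : (V -> N) -> Prop) :
    (forall i, definable (Q i)) -> (forall e e', (forall i, Q i e <-> Q i e') -> R e -> R e') ->
  definable R.
Proof.
move=> QD QR; apply: boolean_closure QD QR; [exact: definable_true| |].
  exact: definable_neg.
exact: definable_and.
Qed.

End Definable.

(** * From tame predicates to mutually algebraic formulas *)

Local Open Scope classical_set_scope.
Local Open Scope card_scope.

Lemma card_le_cover T (A : set T) K (f : nat -> T) :
  (forall b, A b -> exists2 j, j < K & b = f j) -> A #<= `I_K.
Proof.
move=> Af; apply: card_le_trans (card_image_le f `I_K); apply: subset_card_le.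
by move=> b /Af[j jK ->]; exists j.
Qed.

Lemma card_le_covered T (A : set T) K (t0 : T) : A #<= `I_K ->
  exists f : nat -> T, forall b, A b -> exists2 j, j < K & b = f j.
Proof.
move=> /pcard_leP/unsquash f.
have /choice[g gP] : forall j, exists t, forall b, A b -> f b = j -> b = t.
  move=> j; have [[b Ab fb]|nb] := pselect (exists2 b, A b & f b = j); last first.
    by exists t0 => b Ab fb; case: nb; exists b.
  exists b => b' Ab' fb'; apply: (@inj _ _ _ f); [exact: mem_set|exact: mem_set|].
  exact: (etrans fb' (esym fb)).
exists g => b Ab; exists (f b); last exact: gP.
exact: (@funS _ _ _ _ f).
Qed.

Section Combination.
Variables (U : Type) (M : structure U) (m0 : M) (n : nat).

Definition combination (P : n.-tuple M -> Prop) : Prop :=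
  exists2 psi : pform M n, ma_combination psi & forall b, psat psi b <-> P b.

Lemma penv_sum k (b : k.-tuple M) : penv b = sum_env (tnth b).
Proof. by apply/funext => -[]. Qed.

(** Truth is an atom in zero variables, since no empty tuple contains an element; in all [n]
    variables it need not be mutually algebraic. *)
Lemma combination_true : combination (fun=> True).
Proof.
exists (prename (of_I0 _) (Neg (Ex (Neg (Eq U None None))) : pform M 0)).
  apply: ma_comb_atom => [[]//|]; exists 0 => m.
  by apply: (@card_le_cover _ _ _ (fun=> [tuple])) => b [_ [[]]].
by move=> b; split=> // _ [m]; apply.
Qed.

(** Variables outside the scope are replaced by the parameter [m0], leaving a formula in the
    subtuple of the scope. The bound becomes [#|A| * K] because [ma_relation] lets the given element
    stand at any position. *)
Lemma combination_atom K S (R : ('I_n -> M) -> Prop) :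
  ma_on K S R -> definable R -> combination (fun b => R (tnth b)).
Proof.
move=> [RS RK] [psi psiP].
pose A := [set i | `[< S i >]]%SET.
pose h : 'I_#|A| -> 'I_n := enum_val.
have hI : injective h := @enum_val_inj _ _.
have hS i : S (h i) by have := enum_valP i; rewrite inE => /asboolP.
have Sh j : S j -> exists i, h i = j.
  move=> Sj; have jA : j \in A by rewrite inE; apply/asboolP.
  by exists (enum_rank_in jA j); apply: enum_rankK_in.
pose g (v : 'I_n + M) : 'I_#|A| + M := match v with
  | inl j => if [pick i | h i == j] is Some i then inl i else inr m0
  | inr m => inr m end.
pose e (b : #|A|.-tuple M) j := penv b (g (inl j)).
have eh b i : e b (h i) = tnth b i.
  rewrite /e /=; case: pickP => [i' /eqP/hI -> //|/(_ i)].
  by rewrite eqxx.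
have gE b : penv b \o g = sum_env (e b) by apply/funext => -[].
exists (prename h (form_map g psi)); last first.
  move=> b; rewrite /psat /prename !sat_map.
  rewrite (_ : _ \o _ = sum_env (e [tuple tnth b (h i) | i < #|A|])); last first.
    apply/funext => -[j|m] //=; rewrite /e /=.
    by case: pickP => [i _|_] //=; rewrite tnth_mktuple.
  rewrite -psiP; split; apply: RS => j /Sh[i <-]; by rewrite eh tnth_mktuple.
apply: ma_comb_atom => //.
have /choice[L LP] : forall p : 'I_#|A| * M, exists L : nat -> 'I_n -> M,
    forall e, R e -> e (h p.1) = p.2 -> exists2 j, j < K & agree S e (L j).
  by move=> [i m]; apply: RK.
exists (#|A| * K) => m.
pose f a : #|A|.-tuple M := if insub (a %/ K) is Some i
  then [tuple L (i, m) (a %% K) (h i') | i' < #|A|] else [tuple m | _ < #|A|].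
apply: (@card_le_cover _ _ _ f) => b [Rb0 [i bi]].
have Rb : R (e b).
  by apply: (proj2 (psiP _)); rewrite -gE; apply: (proj1 (sat_map psi g (penv b))).
have [|j jK ej] := LP (i, m) (e b) Rb; first by rewrite /= eh.
exists (i * K + j).
  by apply: leq_trans (leq_mul (ltn_ord i) (leqnn K)); rewrite mulSn addnC ltn_add2r.
rewrite /f divnMDl ?(leq_ltn_trans _ jK) // divn_small // addn0 modnMDl modn_small // valK.
by apply/eq_from_tnth => i'; rewrite tnth_mktuple -eh; apply: ej.
Qed.

Lemma combination_det (I : finType) (Q : I -> n.-tuple M -> Prop) (R : n.-tuple M -> Prop) :
    (forall i, combination (Q i)) -> (forall b b', (forall i, Q i b <-> Q i b') -> R b -> R b') ->
  combination R.
Proof.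
move=> QC QR; apply: boolean_closure QC QR; [exact: combination_true| |].
  by move=> P [psi psiC psiP]; exists (Neg psi) => [|b]; [constructor|rewrite -psiP].
move=> P P' [psi psiC psiP] [psi' psiC' psiP'].
by exists (And psi psi') => [|b]; [constructor|rewrite -psiP -psiP'].
Qed.

End Combination.

(** The elimination treats the parameters as free variables. Freezing each to its own value
    afterwards keeps mutual algebraicity, by projection to the variables proper. *)
Lemma tame_mutually_algebraic (U : Type) (M : structure U) (I : finType) K :
    tame (@definable U M) I K (fun e : 'I_2 -> M => sadj (e ord0) (e ord_max)) ->
  mutually_algebraic M.
Proof.
move=> tE n phi.
have [[m0]|nM] := pselect (inhabited M); last first.
  exists (prename id phi).
    by apply: ma_comb_atom => //; exists 0 => m; case: nM.
  move=> b; rewrite /psat /prename sat_map (_ : _ \o _ = penv b) //.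
  by apply/funext => -[].
have [I' [K' H]] := @sat_tame U I K _ phi.
have [Q [QD Qphi]] := H M _ (closed_definable M) tE.
have [psi psiC psiP] : combination (fun b : n.-tuple M => psat phi b).
  apply: (@combination_det _ _ _ I' (fun i (b : n.-tuple M) => Q i (penv b))); last first.
    by move=> b b' bb'; apply: Qphi.
  move=> i; have [[S SQ] [psi psiP]] := QD i.
  have inlI : injective (@inl 'I_n M) by move=> x y [].
  have SQ' := ma_on_proj inlI SQ.
  suff [psi' psiC' psiP'] : combination (fun b : n.-tuple M => Q i (sum_env (tnth b))).
    by exists psi' => // b; rewrite psiP' penv_sum.
  apply: (@combination_atom _ _ m0 _ K' (S \o inl) (fun e => Q i (sum_env e))).
    apply: ma_on_sub SQ' => [e e' ee'|e Qe]; last by exists (sum_env e).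
    by apply: (proj1 SQ) => -[v|m] //= /ee'.
  exists (form_map (fun v => match v with inl v => v | inr m => inr m end) psi) => e.
  by rewrite sat_map psiP (_ : _ \o _ = sum_env (sum_env e)) //; apply/funext => -[[]|].
by exists psi => // b; rewrite psiP.
Qed.

(** * Near covers in infinite models *)

Definition differ_form U V (K : nat) (x y : V) : form U V :=
  Exn (And (distinct_form U (inl ord0) (@inl 'I_K.+1 V))
    (Allf (inl ord0) (fun i : 'I_K.+1 =>
       Neg (Iff (Adj U (inr x) (inl i)) (Adj U (inr y) (inl i)))))).

Lemma sat_differ_form U (M : structure U) V K (x y : V) (e : V -> M) :
  sat (differ_form U K x y) e <-> exists2 b : 'I_K.+1 -> M, injective b &
    forall i, ~ (sadj (e x) (b i) <-> sadj (e y) (b i)).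
Proof.
rewrite sat_Exn; split=> [[b [bI bP]]|[b bI bP]]; exists b.
- exact: (proj1 (sat_distinct_form _ _ _) bI).
- move=> i H; apply: (proj1 (sat_Allf _ _ _) bP i).
  exact: (proj2 (sat_Iff (Adj U (inr x) (inl i)) (Adj U (inr y) (inl i)) (envn b e))).
split; first by apply: (proj2 (sat_distinct_form _ _ _)).
apply: (proj2 (sat_Allf _ _ _)) => i H; apply: (bP i).
exact: (proj1 (sat_Iff (Adj U (inr x) (inl i)) (Adj U (inr y) (inl i)) (envn b e))).
Qed.

Definition far_sentence K : sentence void :=
  Exn (Allf (inl ord0) (fun p : 'I_K.+1 * 'I_K.+1 =>
    if p.1 == p.2 then Eq void (inl ord0) (inl ord0)
    else differ_form void K (inl p.1) (inl p.2))).

Lemma holds_far_sentence (M : structure void) K :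
  holds M (far_sentence K) <-> far (@sadj void M) K.+1.
Proof.
rewrite /holds sat_Exn; split=> -[b bP]; exists b.
  move=> l l' ll'; have := proj1 (sat_Allf _ _ _) bP (l, l') => /=.
  by rewrite (negPf ll') sat_differ_form.
apply/sat_Allf => -[l l'] /=; case: eqP => // /eqP ll'.
by rewrite sat_differ_form; apply: bP.
Qed.

Lemma Th_class_symmetric C (M : structure void) :
  model_of (Th_class C) M -> forall x y : M, sadj x y -> sadj y x.
Proof.
pose phi : sentence void := All (All (Imp (Adj _ (Some None) None) (Adj _ None (Some None)))).
have phiE (N : structure void) : holds N phi <-> forall x y : N, sadj x y -> sadj y x.
  rewrite /holds sat_All; split=> H x.
    move=> y; exact: (proj1 (sat_Imp _ _ _) (proj1 (sat_All _ _) (H x) y)).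
  by apply: (proj2 (sat_All _ _)) => y; apply: (proj2 (sat_Imp _ _ _)); apply: H.
by move=> /(_ phi) H; apply/phiE/H => G _; apply/phiE => x y /=; rewrite adj_sym.
Qed.

Lemma ma_on_unary (M V : Type) (w : V) (P : M -> Prop) :
  ma_on 1 (fun v => v = w) (fun e => P (e w)).
Proof.
split=> [e e' ee'|v m ->]; first by rewrite ee'.
by exists (fun _ _ => m) => e _ em; exists 0 => // v' ->.
Qed.

Lemma ma_on_pair (M : Type) k (R : M -> M -> Prop) :
    (forall x y, R x y -> R y x) -> (forall x, atmost k (R x : {classic M} -> Prop)) ->
  ma_on k (fun=> True) (fun e : 'I_2 -> M => R (e ord0) (e ord_max)).
Proof.
move=> Rsym Rk; split=> [e e' ee'|v m _]; first by rewrite !ee'.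
have [s [_ sk sP]] := atmost_list (Rk m).
exists (fun j w => if w == v then m else nth m s j) => e Re ev.
have Rw : R m (e (swap2 v)).
  by move: Re; rewrite -ev; case: (ord2E v) => -> //=; apply: Rsym.
move/sP: Rw => ws; exists (index (e (swap2 v) : {classic M}) s).
  by apply: leq_trans sk; rewrite index_mem.
move=> w _; have [->|wv] := eqVneq w v; first by [].
have -> : nth m s (index (e (swap2 v) : {classic M}) s) = e (swap2 v).
  exact: (@nth_index {classic M} m _ s ws).
congr e.
by move: wv; case: (ord2E v) => ->; case: (ord2E w) => ->.
Qed.

(** Adjacency is determined by the bits of the codes, which are unary, and by the relation of
    misprediction, which is symmetric of bounded degree; all are definable from the representatives
    and the listed vertices. *)
Lemma near_covered_ma C : graph_class C -> near_covered C -> ma_class C.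
Proof.
move=> [_ C0] [[|K] CK] M MT.
  by case: (CK _ C0); exists (fun i => of_I0 _ i); case.
have Esym := Th_class_symmetric MT.
have nfar : ~ far (@sadj void M) K.+1.
  move/holds_far_sentence; apply: (MT (Neg (far_sentence K))) => G CG.
  by move/holds_far_sentence; apply: CK.
have [[x0]|nM] := pselect (inhabited M); last first.
  apply: (@tame_mutually_algebraic _ _ unit 0); exists (fun _ _ => False).
  split=> [_|e]; last by case: nM; exists; apply: (e ord0).
  by split; [exists (fun=> False)|apply: (D_false (closed_definable M))].
pose E : {classic M} -> {classic M} -> Prop := @sadj void M.
have Es (x y : {classic M}) : E x y -> E y x := Esym x y.
have [a [t [aP tP]]] := @near_cover_listing {classic M} E K x0 nfar.
set N := K * _ in t tP.
pose bit (i : 'I_K + 'I_N + 'I_N) : {classic M} -> Prop := match i with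
  | inl (inl i) => fun x => twins E K x (a i)
  | inl (inr i) => fun x => x = t i
  | inr i => fun x => E x (t i) end.
have tau_bit x y : (forall i, bit i x <-> bit i y) -> tau E a t x = tau E a t y.
  move=> xy; congr (_, _, _); apply/ffunP => i; rewrite !ffunE.
  - by apply/asbool_equiv_eq; apply: (xy (inl (inl i))).
  - by apply/eqP/eqP => /(xy (inl (inr i))).
  - by apply/asbool_equiv_eq; apply: (xy (inr i)).
pose R x y := ~ (E x y <-> link E a (tau E a t x) (tau E a t y)).
have bitD i w : @definable void M 'I_2 (fun e => bit i (e w)).
  case: i => [[i|i]|i].
  - exists (Neg (differ_form void K (inl w) (inr (a i)))) => e /=.
    rewrite -/(sat _ _) sat_differ_form; split=> [tw [b bI bP]|nb].
      exact: (@atmost_inj {classic M} K (differ E (e w) (a i)) b bI bP tw).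
    by apply: contrapT => /not_atmost[b bI bP]; apply: nb; exists b.
  - by exists (Eq void (inl w) (inr (t i))).
  - by exists (Adj void (inl w) (inr (t i))).
have RD : @definable void M 'I_2 (fun e => R (e ord0) (e ord_max)).
  pose Q (x : ('I_K + 'I_N + 'I_N) * 'I_2 + unit) (e : 'I_2 -> M) := match x with
    | inl (i, w) => bit i (e w) | inr _ => E (e ord0) (e ord_max) end.
  apply: (@definable_det _ _ _ _ Q).
    by move=> [[i w]|[]]; [exact: (bitD i w)|exists (Adj void (inl ord0) (inl ord_max))].
  move=> e e' ee'; rewrite /R.
  have tw w : tau E a t (e w) = tau E a t (e' w).
    by apply: tau_bit => i; apply: (ee' (inl (i, w))).
  by have /= -> := ee' (inr tt); rewrite !tw.
apply: (@tame_mutually_algebraic _ _ (('I_K + 'I_N + 'I_N) * 'I_2 + unit)%type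
  (1 + K * (4 * (K + K) + (K + K)))).
exists (fun x e => match x with
  | inl (i, w) => bit i (e w) | inr _ => R (e ord0) (e ord_max) end); split.
  move=> [[i w]|[]]; split=> //.
    exists (fun v => v = w); apply: (ma_on_weaken (leq_addr _ _)); exact: ma_on_unary.
  exists (fun=> True); apply: (ma_on_weaken (leq_addl _ _)); apply: ma_on_pair => [x y|x].
    rewrite /R => nxy yx; apply: nxy; rewrite (link_sym Es aP tP x y).
    by split=> H; [apply/yx/Es|apply/Es/yx].
  exact: (@link_atmost _ _ _ Es a aP _ t tP x).
move=> e e' ee' Exy.
have tw w : tau E a t (e w) = tau E a t (e' w).
  by apply: tau_bit => i; apply: (ee' (inl (i, w))).
have := ee' (inr tt); rewrite /R !tw => RR.
apply: contrapT => nE.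
case: (boolP (link E a (tau E a t (e' ord0)) (tau E a t (e' ord_max)))) RR => lk RR.
  by have [_ H] := RR; apply: H => [[_ /(_ isT)]//|]; split.
by have [H _] := RR; apply: (H _) => [[/(_ Exy)]//|]; split=> // /nE.
Qed.

(** * Ultraproducts *)

Section Ultraproduct.
Variables (U : Type) (N : nat -> structure U) (n0 : forall k, N k).
Variables (F : set_system nat) (FU : UltraFilter F).

Let seqs := forall k, N k.
Definition eq_ae (f g : seqs) : Prop := F [set k | f k = g k].
Definition ae_class (f : seqs) : set seqs := [set g | eq_ae f g].
Definition ultraproduct_carrier : Type := {A : set seqs | exists f, A = ae_class f}.

Definition repr (q : ultraproduct_carrier) : seqs := projT1 (cid (proj2_sig q)).

Lemma repr_class q : sval q = ae_class (repr q).
Proof. exact: (projT2 (cid (proj2_sig q))). Qed.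

Definition to_class (f : seqs) : ultraproduct_carrier :=
  exist _ (ae_class f) (ex_intro _ f erefl).

Lemma eq_ae_refl f : eq_ae f f.
Proof. by apply: filterS filterT => k _ /=. Qed.

Lemma eq_ae_sym f g : eq_ae f g -> eq_ae g f.
Proof. by apply: filterS => k /= ->. Qed.

Lemma eq_ae_trans f g h : eq_ae f g -> eq_ae g h -> eq_ae f h.
Proof. by move=> fg gh; apply: filterS (filterI fg gh) => k /= [-> ->]. Qed.

Lemma eq_reprP q r : q = r <-> eq_ae (repr q) (repr r).
Proof.
split=> [->|qr]; first exact: eq_ae_refl.
apply: eq_sig_hprop => [A|]; first exact: Prop_irrelevance.
rewrite !repr_class; apply/seteqP; split=> f /=.
  by apply: eq_ae_trans; apply: eq_ae_sym.
exact: eq_ae_trans.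
Qed.

Lemma repr_to_class f : eq_ae f (repr (to_class f)).
Proof.
have : ae_class (repr (to_class f)) f by rewrite -repr_class; apply: eq_ae_refl.
exact: eq_ae_sym.
Qed.

(** Relations are evaluated on chosen representatives, so no compatibility with the classes has to
    be shown. *)
Definition ultraproduct : structure U :=
  @Structure U ultraproduct_carrier
    (fun q r => F [set k | sadj (repr q k) (repr r k)])
    (fun u q => F [set k | scol u (repr q k)]).

Lemma ultra_not (A : set nat) : F (~` A) <-> ~ F A.
Proof.
split=> [FnA FA|nFA]; last by case: (in_ultra_setVsetC A FU).
have : F (A `&` ~` A) by apply: filterI.
by rewrite setICr; apply: filter_not_empty.
Qed.

Theorem ultraproduct_sat V (phi : form U V) (e : V -> ultraproduct) :
  sat phi e <-> F [set k | sat phi (fun v => repr (e v) k)].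
Proof.
elim: phi e => {V} [V x y|V x y|V u x|V p IH|V p IHp q IHq|V p IH] e.
- exact: eq_reprP.
- by [].
- by [].
- by rewrite [sat _ _]/= IH -ultra_not.
- rewrite [sat _ _]/= IHp IHq; split=> [[Fp Fq]|H].
    by apply: filterS (filterI Fp Fq) => k [].
  by split; apply: filterS H => k [].
split=> [[m /IH]|H].
  apply: filterS => k Hk; exists (repr m k); congr (sat p _): Hk.
  by apply/funext; case.
(* A witness is chosen in each factor that has one; elsewhere the value is the arbitrary [n0 k]. *)
have [g gP] : exists g : seqs, forall k, (exists m, sat p (oapp (fun v => repr (e v) k) m)) ->
    sat p (oapp (fun v => repr (e v) k) (g k)).
  have gk k : {m : N k | (exists m, sat p (oapp (fun v => repr (e v) k) m)) ->
      sat p (oapp (fun v => repr (e v) k) m)}.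
    apply: cid; have [[m mP]|nm] := pselect (exists m, sat p (oapp (fun v => repr (e v) k) m)).
      by exists m.
    by exists (n0 k).
  by exists (fun k => sval (gk k)) => k; apply: (svalP (gk k)).
exists (to_class g); apply/IH.
apply: filterS (filterI H (repr_to_class g)) => k [/gP Hk gk]; congr (sat p _): Hk.
by apply/funext => -[v|] //=.
Qed.

End Ultraproduct.

(** * From mutual algebraicity back to near covers *)

Lemma far_leq (M : Type) (E : M -> M -> Prop) j k : j <= k -> far E k -> far E j.
Proof.
move=> jk [x xP]; exists (fun l => x (widen_ord jk l)) => l l' ll'.
have [b bI bP] := xP (widen_ord jk l) (widen_ord jk l') ll'.
exists (fun i => b (widen_ord jk i)) => [i i' /bI/(congr1 val)/= /val_inj//|i].
exact: bP.
Qed.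

(** With the collection of all predicates, parameters are absorbed into the predicates and only the
    numerical bound is kept. *)
Lemma ma_combination_tame (U : Type) (M : structure U) n (psi : pform M n) :
  ma_combination psi -> exists (I : finType) (K : nat),
    tame (fun _ _ => True) I K (fun e : 'I_n -> M => psat psi [tuple e i | i < n]).
Proof.
elim=> {psi} [k h phi hI [K phiK]|psi _ [I [K IH]]|psi psi' _ [I [K IH]] _ [I' [K' IH']]].
- exists unit, K; apply: (@tame_atom U M _ _ _ (fun v => exists i, h i = v)) => //.
  have phiE (e : 'I_n -> M) : psat (prename h phi) [tuple e i | i < n] <->
      psat phi [tuple e (h i) | i < k].
    rewrite /psat /prename sat_map (_ : _ \o _ = penv [tuple e (h i) | i < k]) //.
    by apply/funext => -[i|m] //=; rewrite !tnth_mktuple.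
  split=> [e e' ee' /phiE Re|_ m [i <-]].
    apply/phiE; congr (psat phi _): Re; apply: eq_from_tnth => i.
    by rewrite !tnth_mktuple; apply: ee'; exists i.
  have [f fP] := card_le_covered [tuple m | _ < k] (phiK m).
  exists (fun j w => if [pick i | h i == w] is Some i then tnth (f j) i else m).
  move=> e /phiE Re em; have [|j jK fj] := fP [tuple e (h i) | i < k].
    by split=> //; exists i; rewrite tnth_mktuple.
  exists j => // _ [i' <-]; case: pickP => [i1 /eqP/hI ->|/(_ i')]; last by rewrite eqxx.
  by rewrite -fj tnth_mktuple.
- by exists I, K; apply: (@tame_neg U M).
- by exists (I + I')%type, (maxn K K'); apply: (@tame_and U M).
Qed.

Lemma mutually_algebraic_edge_tame (U : Type) (M : structure U) :
  mutually_algebraic M -> exists (I : finType) (K : nat), edge_tame I K (@sadj U M).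
Proof.
move=> /(_ 2 (Adj U (inl ord0) (inl ord_max)))[psi /ma_combination_tame[I [K psiK]] psiP].
exists I, K; apply: (@tame_ext U M _ _ _ _ _ _ _ psiK) => e.
by rewrite -psiP /psat /= !tnth_mktuple.
Qed.

Lemma ma_near_covered C : ma_class C -> near_covered C.
Proof.
move=> Cma; apply: contrapT => nC.
have G k : {G : sgraph | C G & far (fun x y : G => adj x y) k.+1}.
  apply: cid2; apply: contrapT => nG; apply: nC; exists k.+1 => H CH Hfar.
  by apply: nG; exists H.
pose N k := graph_structure (s2val (G k)).
have n0 k : N k by case: (cid (s2valP' (G k))) => x _; exact: (x ord0).
have [F [FU oF]] := ultraFilterLemma eventually_filter.
pose M := ultraproduct N F.
have MT : model_of (Th_class C) M.
  move=> phi phiC; apply/(ultraproduct_sat n0); apply: filterS filterT => k _ /=.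
  have := phiC _ (s2valP (G k)); congr (sat phi _).
  by apply/funext; case.
have [I [K MK]] := mutually_algebraic_edge_tame (Cma M MT).
have [K' nfar] := tame_not_far I K.
(* [far_sentence K'] expresses [far] at [K'.+1]. It holds in all but finitely many factors, hence in
   the ultraproduct. *)
apply: (nfar _ _ MK); apply: far_leq (leqnSn K') _; apply/holds_far_sentence.
apply/(ultraproduct_sat n0); apply: oF; exists K' => // k /= Kk.
have : holds (N k) (far_sentence K').
  by apply/holds_far_sentence; apply: far_leq (s2valP' (G k)).
by congr (sat _ _); apply/funext; case.
Qed.

Lemma tame_near_covered C : tame_class C -> near_covered C.
Proof.
move=> [I [K CK]]; have [K' nfar] := tame_not_far I K; exists K' => G /CK.
exact: nfar.
Qed.

Theorem theorem20p3 (C : graphs)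
    (C_class : graph_class C) (C_hereditary : hereditary C) :
  [<-> ma_class C;
       exists D : graphs,
         [/\ graph_class D, hereditary D, bounded_degree D
           & transduction_equivalent C D];
       exists D : graphs,
         [/\ graph_class D, hereditary D, bounded_degree D,
             transduction_equivalent C D & perturbation_of C D];
       transduction_of C cubic_graphs;
       ~ transduction_of star_forests C;
       ~ noncopying_transduction_of star_forests C].
Proof.
have cubicB : bounded_degree cubic_graphs by exists 3 => G Gcub x; rewrite Gcub.
have NC3 := near_covered_perturbation C_class C_hereditary.
have BNC D : bounded_degree D -> transduction_of C D -> near_covered C.
  by move=> /bounded_degree_tame/transduction_tame/[apply]/tame_near_covered.
tfae.
- move=> /ma_near_covered/NC3[D [Dc Dh Db CD _]]; by exists D.
- by move=> [D [_ _ Db [CD _]]]; apply/NC3/(BNC D).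
- move=> [D [_ _ Db _ CD]]; apply: noncopying_transduction.
  exact: perturbation_cubic CD.
- move=> Ccub starC; apply: star_forests_far; apply: tame_near_covered.
  apply: transduction_tame starC; apply: transduction_tame Ccub.
  exact: bounded_degree_tame.
- by move=> nstar /noncopying_transduction.
- move=> nstar; apply: near_covered_ma => //.
  by apply: contrapT => /not_near_covered_star_forests.
Qed.
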